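(* Let $\{(X_i,Y_i)\}_{i\ge1}$ be i.i.d. and let $S$ be a permutation invariant stopping time with respect to $\{X_i\}_{i\ge1}$. If all $\{\mathcal T^m\}_{m=0}^M$ are permutation invariant (i.e. the stopping times $T(\mathcal T^m)$ are permutation invariant), then the algorithm described in the context has a running time polynomial in $\kappa$.
   Context: The $X_i$'s and $Y_i$'s take values in finite alphabets $\mathcal X$ and $\mathcal Y$; $X^n=(X_1,\dots,X_n)$, $Y^n=(Y_1,\dots,Y_n)$; ''i.i.d.'' means the pairs $(X_i,Y_i)$ are i.i.d. over $i$. A (possibly randomized) stopping time with respect to $\{X_i\}_{i\ge1}$ is an integer-valued random variable $S$ such that for each $n$ the event $\{S=n\}$, conditioned on $X^n$, is independent of $\{X_i\}_{i>n}$; similarly for $\{Y_i\}_{i\ge1}$. $S$ has positive integer values and $S\le\kappa$ almost surely for some constant $\kappa\ge1$. A stopping time $S$ with respect to $\{X_i\}_{i\ge1}$ is permutation invariant if $\mathbb P(S\le n\mid X^n=x^n)=\mathbb P(S\le n\mid X^n=\pi(x^n))$ for all permutations $\pi$ of the $n$ coordinates, all $x^n\in\mathcal X^n$ and $n\in\{1,\dots,\kappa\}$; similarly for $\{Y_i\}_{i\ge1}$. For $\alpha\in[0,1]$, $d(\alpha)$ is the minimum of $\mathbb E(T-S)^+$ over all possibly randomized stopping times $T\le\kappa$ with respect to $\{Y_i\}_{i\ge1}$ such that $\mathbb P(T<S)\le\alpha$; it is convex and piecewise linear, and the algorithm computes its break-points $\{(\alpha_m,d_m)\}_{m=1}^M$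 together with the associated trees $\{\mathcal T^m\}_{m=0}^M$. A $|\mathcal Y|$-ary tree has nodes labelled by finite strings over $\mathcal Y$ (root: empty string; children of $\boldsymbol y$: $\boldsymbol y\gamma$, $\gamma\in\mathcal Y$), every node having $0$ or exactly $|\mathcal Y|$ children. $\mathcal L(\mathcal T)$, $\mathcal I(\mathcal T)$ are the sets of leaves and of non-leaf nodes; $\mathcal T_{\boldsymbol y}$ is the subtree of $\mathcal T$ rooted in $\boldsymbol y$; $\mathcal D(\mathcal T_{\boldsymbol y})$ is the set of strict descendants of $\boldsymbol y$ in $\mathcal T$. $T(\mathcal T)$ is the non-randomized stopping time with respect to $\{Y_i\}_{i\ge1}$ stopping at the first $n$ with $Y^n$ a leaf of $\mathcal T$. For a string $\boldsymbol y$ of length $n$, $a(\boldsymbol y)=\mathbb P(Y^n=\boldsymbol y)\,\mathbb P(S>n\mid Y^n=\boldsymbol y)$ and $b(\boldsymbol y)=\mathbb P(Y^n=\boldsymbol y)\,\mathbb E((n-S)^+\mid Y^n=\boldsymbol y)$ (both $0$ if $\mathbb P(Y^n=\boldsymbol y)=0$); $a(\mathcal T_{\boldsymbol y})$, $b(\mathcal T_{\boldsymbol y})$ are the sums of $a$, $b$ over $\mathcal L(\mathcal T_{\boldsymbol y})$, and for $\boldsymbol y\in\mathcal I(\mathcal T)$ $$g(\boldsymbol y,\mathcal T)=\frac{b(\mathcal T_{\boldsymbol y})-b(\boldsymbol y)}{a(\boldsymbol y)-a(\mathcal T_{\boldsymbol y})},$$ where $0/0$ is set equal to $0$. Algorithm: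 start with $m=0$, $\lambda_0=\infty$ and $\mathcal T^0$ the complete $|\mathcal Y|$-ary tree of depth $\kappa$. Repeat: increase $m$ by $1$; set $$\lambda_m=\max_{\boldsymbol y\in\mathcal I(\mathcal T^{m-1})}g(\boldsymbol y,\mathcal T^{m-1}),\qquad \mathcal T^m=\mathcal T^{m-1}\setminus\bigcup_{\boldsymbol y\in\mathcal I(\mathcal T^{m-1}):\,g(\boldsymbol y,\mathcal T^{m-1})=\lambda_m}\mathcal D(\mathcal T^{m-1}_{\boldsymbol y})$$ (with $\lambda_m=0$ if $\mathcal T^{m-1}$ consists of the root only); set $\alpha_m=\mathbb P(T(\mathcal T^m)<S)$ and $d_m=\mathbb E(T(\mathcal T^m)-S)^+$; until $\lambda_m=0$. Finally set $M=m-1$. Input of the algorithm: a list of the probabilities $\mathbb P(S\le n\mid X^n=x^n)$ for $x^n\in\mathcal X^n$ and $n\in\{1,\dots,\kappa\}$, specifying $S$, where by permutation invariance only one entry is needed for each composition (type, i.e. vector of symbol counts) of $x^n$, and where, given $x^n$, the entry can be accessed in $O(\kappa)$ time; and a list of $\mathbb P(X=x,Y=y)$ for all $x\in\mathcal X$, $y\in\mathcal Y$, characterizing the distribution of the process $\{(X_i,Y_i)\}_{i\ge1}$.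
   Formalization: It is assumed in addition that the randomization of S does not use the Y's: given X^N, the event {S=n} is independent of Y^N; otherwise the input list does not determine the algorithm's output. *)

(* Defs.v *)
From HB Require Import structures.
From mathcomp Require Import all_boot all_order all_fingroup all_algebra.
From mathcomp Require Import all_classical all_reals all_analysis.
Set Implicit Arguments.
Unset Strict Implicit.
Unset Printing Implicit Defensive.
Import Order.TTheory GRing.Theory Num.Theory.
Import numFieldNormedType.Exports.

Local Open Scope classical_set_scope.
Local Open Scope ring_scope.

Definition Pr (R : realType) (d : measure_display) (Om : measurableType d)
  (P : probability Om R) (E : set Om) : R := fine (P E).

(* Elementary conditioning on an event; as x / 0 = 0 in MathComp, both are 0
   when P B = 0. *)
Definition cPr (R : realType) (d : measure_display) (Om : measurableType d)
  (P : probability Om R) (E B : set Om) : R := Pr P (E `&` B) / Pr P B.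

Definition cE (R : realType) (d : measure_display) (Om : measurableType d)
  (P : probability Om R) (f : Om -> R) (B : set Om) : R :=
  (\int[P]_(w in B) f w) / Pr P B.

Definition discrete_rv (d : measure_display) (Om : measurableType d) (A : Type)
  (Z : Om -> A) : Prop := forall z : A, measurable (Z @^-1` [set z]).

(* Processes are indexed from 0: Z_1, Z_2, ... of the usual numbering are
   Z 0, Z 1, ..., so that Z^n = (Z 0, ..., Z (n-1)). *)
Definition starts_with (Om : Type) (A : Type) (Z : nat -> Om -> A) (s : seq A) :
  set Om := [set w | mkseq (Z^~ w) (size s) = s].

Definition cylinder (Om : Type) (A : Type) (Z : nat -> Om -> A) (J : seq nat)
  (B : nat -> set A) : set Om := [set w | forall i, i \in J -> B i (Z i w)].

Definition iid (R : realType) (d : measure_display) (Om : measurableType d)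
  (P : probability Om R) (A : Type) (Z : nat -> Om -> A) : Prop :=
  [/\ forall i, discrete_rv (Z i),
      forall (J : seq nat) (B : nat -> set A), uniq J ->
        Pr P (cylinder Z J B) = \prod_(i <- J) Pr P (Z i @^-1` B i)
    & forall (i : nat) (B : set A), Pr P (Z i @^-1` B) = Pr P (Z 0%N @^-1` B)].

Definition stopping_time (R : realType) (d : measure_display)
  (Om : measurableType d) (P : probability Om R) (A : Type)
  (Z : nat -> Om -> A) (S : Om -> nat) : Prop :=
  discrete_rv S /\
  forall (n : nat) (z : n.-tuple A) (J : seq nat) (B : nat -> set A),
    (forall i, i \in J -> (n <= i)%N) ->
    cPr P ((S @^-1` [set n]) `&` cylinder Z J B) (starts_with Z z) =
    cPr P (S @^-1` [set n]) (starts_with Z z) *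
    cPr P (cylinder Z J B) (starts_with Z z).

(* The randomization of S is independent of the observations: given X^N, the
   event {S = n} is independent of Y^N. *)
Definition independent_randomization (R : realType) (d : measure_display)
  (Om : measurableType d) (P : probability Om R) (A B : Type)
  (X : nat -> Om -> A) (Y : nat -> Om -> B) (S : Om -> nat) : Prop :=
  forall (n N : nat) (x : N.-tuple A) (y : N.-tuple B),
    cPr P ((S @^-1` [set n]) `&` starts_with Y y) (starts_with X x) =
    cPr P (S @^-1` [set n]) (starts_with X x) *
    cPr P (starts_with Y y) (starts_with X x).

Definition permutation_invariant (R : realType) (d : measure_display)
  (Om : measurableType d) (P : probability Om R) (kappa : nat) (A : Type)
  (Z : nat -> Om -> A) (S : Om -> nat) : Prop :=
  forall (n : nat) (z : n.-tuple A) (p : 'S_n), (1 <= n <= kappa)%N ->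
    cPr P [set w | (S w <= n)%N] (starts_with Z z) =
    cPr P [set w | (S w <= n)%N] (starts_with Z [tuple tnth z (p i) | i < n]).

(* A subtree of the complete tree of depth kappa is represented by the set of
   its nodes. *)

Definition child (A : finType) (y z : seq A) : bool :=
  [exists c : A, z == rcons y c].

Definition is_leaf (kappa : nat) (A : finType) (T : {set kappa.-bseq A})
  (y : kappa.-bseq A) : bool :=
  (y \in T) && [forall z in T, ~~ child y z].

Definition leaves (kappa : nat) (A : finType) (T : {set kappa.-bseq A}) :
  {set kappa.-bseq A} := [set y | is_leaf T y]%SET.

Definition internal (kappa : nat) (A : finType) (T : {set kappa.-bseq A}) :
  {set kappa.-bseq A} := T :\: leaves T.

Definition strict_descendants (kappa : nat) (A : finType)
  (T : {set kappa.-bseq A}) (y : kappa.-bseq A) : {set kappa.-bseq A} :=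
  [set z in T | prefix y z && (z != y)]%SET.

Definition subtree_leaves (kappa : nat) (A : finType)
  (T : {set kappa.-bseq A}) (y : kappa.-bseq A) : {set kappa.-bseq A} :=
  [set z in leaves T | prefix y z]%SET.

(* First n with Y^n a leaf (kappa.+1 if none, which cannot happen in a tree). *)
Definition tree_time (Om : Type) (kappa : nat) (A : finType)
  (Y : nat -> Om -> A) (T : {set kappa.-bseq A}) (w : Om) : nat :=
  find (fun n => [exists y in leaves T, val y == mkseq (Y^~ w) n])
       (iota 0 kappa.+1).

Definition a_ (R : realType) (d : measure_display) (Om : measurableType d)
  (P : probability Om R) (A : Type) (Y : nat -> Om -> A) (S : Om -> nat)
  (y : seq A) : R :=
  Pr P (starts_with Y y) *
  cPr P [set w | (size y < S w)%N] (starts_with Y y).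

Definition b_ (R : realType) (d : measure_display) (Om : measurableType d)
  (P : probability Om R) (A : Type) (Y : nat -> Om -> A) (S : Om -> nat)
  (y : seq A) : R :=
  Pr P (starts_with Y y) *
  cE P (fun w => (size y - S w)%N%:R) (starts_with Y y).

(* 0 / 0 = 0, and a positive numerator over 0 gives +oo (which occurs, e.g.,
   at a node where S has already stopped almost surely). *)
Definition g_ (R : realType) (d : measure_display) (Om : measurableType d)
  (P : probability Om R) (kappa : nat) (A : finType) (Y : nat -> Om -> A)
  (S : Om -> nat) (T : {set kappa.-bseq A}) (y : kappa.-bseq A) : \bar R :=
  let num := \sum_(z in subtree_leaves T y) b_ P Y S z - b_ P Y S y in
  let den := a_ P Y S y - \sum_(z in subtree_leaves T y) a_ P Y S z in
  if den == 0 then (if num == 0 then 0%E else +oo%E) else (num / den)%:E.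

Definition max_g (R : realType) (d : measure_display) (Om : measurableType d)
  (P : probability Om R) (kappa : nat) (A : finType) (Y : nat -> Om -> A)
  (S : Om -> nat) (T : {set kappa.-bseq A}) : \bar R :=
  if T == [set [bseq]]%SET then 0%E
  else \big[maxe/-oo%E]_(y in internal T) g_ P Y S T y.

Definition prune (R : realType) (d : measure_display) (Om : measurableType d)
  (P : probability Om R) (kappa : nat) (A : finType) (Y : nat -> Om -> A)
  (S : Om -> nat) (T : {set kappa.-bseq A}) : {set kappa.-bseq A} :=
  T :\: \bigcup_(y in internal T | g_ P Y S T y == max_g P Y S T)
          strict_descendants T y.

Definition algo_tree (R : realType) (d : measure_display)
  (Om : measurableType d) (P : probability Om R) (kappa : nat) (A : finType)
  (Y : nat -> Om -> A) (S : Om -> nat) (m : nat) : {set kappa.-bseq A} :=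
  iter m (prune P Y S) [set: kappa.-bseq A]%SET.

Definition algo_lambda (R : realType) (d : measure_display)
  (Om : measurableType d) (P : probability Om R) (kappa : nat) (A : finType)
  (Y : nat -> Om -> A) (S : Om -> nat) (m : nat) : \bar R :=
  if m is m'.+1 then max_g P Y S (algo_tree P kappa Y S m') else +oo%E.

Definition algo_alpha (R : realType) (d : measure_display)
  (Om : measurableType d) (P : probability Om R) (kappa : nat) (A : finType)
  (Y : nat -> Om -> A) (S : Om -> nat) (m : nat) : R :=
  Pr P [set w | (tree_time Y (algo_tree P kappa Y S m) w < S w)%N].

Definition algo_d (R : realType) (d : measure_display)
  (Om : measurableType d) (P : probability Om R) (kappa : nat) (A : finType)
  (Y : nat -> Om -> A) (S : Om -> nat) (m : nat) : R :=
  fine 'E_P[fun w => (tree_time Y (algo_tree P kappa Y S m) w - S w)%N%:R].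

(* The stopping test has failed in rounds 1, ..., m, i.e. m <= M. *)
Definition reaches (R : realType) (d : measure_display)
  (Om : measurableType d) (P : probability Om R) (kappa : nat) (A : finType)
  (Y : nat -> Om -> A) (S : Om -> nat) (m : nat) : Prop :=
  forall k, (1 <= k <= m)%N -> algo_lambda P kappa Y S k <> 0%E.

Definition last_index (R : realType) (d : measure_display)
  (Om : measurableType d) (P : probability Om R) (kappa : nat) (A : finType)
  (Y : nat -> Om -> A) (S : Om -> nat) (M : nat) : Prop :=
  reaches P kappa Y S M /\ algo_lambda P kappa Y S M.+1 = 0%E.

(* Programs work on arrays of naturals and arrays of reals, named by literals
   and indexed by naturals.  On naturals there are only addition and truncated
   subtraction, so that t steps manipulate numbers of O(t) bits; the only
   constants are natural numbers, and reals cannot be converted to naturals. *)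
Inductive iexp : Type :=
| ICst of nat
| IGet of nat & iexp
| IAdd of iexp & iexp
| ISub of iexp & iexp.

Inductive rexp : Type :=
| RCst of nat
| RGet of nat & iexp
| RAdd of rexp & rexp
| RSub of rexp & rexp
| RMul of rexp & rexp
| RDiv of rexp & rexp.

Inductive bexp : Type :=
| BILe of iexp & iexp
| BRLe of rexp & rexp
| BNot of bexp
| BAnd of bexp & bexp.

(* CQuery k e s l consults the list specifying S at the string of length l
   stored at the beginning of the integer array s, and writes the entry into
   cell e of the real array k. *)
Inductive cmd : Type :=
| CSkip
| CISet of nat & iexp & iexp
| CRSet of nat & iexp & rexp
| CSeq of cmd & cmd
| CIf of bexp & cmd & cmd
| CWhile of bexp & cmd
| CQuery of nat & iexp & nat & iexp.

Record memory (R : Type) : Type := Memory {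
  imem : nat -> nat -> nat;
  rmem : nat -> nat -> R }.

Definition upd (V : Type) (f : nat -> nat -> V) (k i : nat) (v : V) :
  nat -> nat -> V :=
  fun k' i' => if (k' == k) && (i' == i) then v else f k' i'.

Definition set_i (R : Type) (s : memory R) (k i v : nat) : memory R :=
  Memory (upd (imem s) k i v) (rmem s).

Definition set_r (R : Type) (s : memory R) (k i : nat) (v : R) : memory R :=
  Memory (imem s) (upd (rmem s) k i v).

Fixpoint ieval (R : Type) (s : memory R) (e : iexp) : nat :=
  match e with
  | ICst n => n
  | IGet k e1 => imem s k (ieval s e1)
  | IAdd e1 e2 => (ieval s e1 + ieval s e2)%N
  | ISub e1 e2 => (ieval s e1 - ieval s e2)%N
  end.

Fixpoint reval (R : realType) (s : memory R) (e : rexp) : R :=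
  match e with
  | RCst n => n%:R
  | RGet k e1 => rmem s k (ieval s e1)
  | RAdd e1 e2 => reval s e1 + reval s e2
  | RSub e1 e2 => reval s e1 - reval s e2
  | RMul e1 e2 => reval s e1 * reval s e2
  | RDiv e1 e2 => reval s e1 / reval s e2
  end.

Fixpoint beval (R : realType) (s : memory R) (e : bexp) : bool :=
  match e with
  | BILe e1 e2 => (ieval s e1 <= ieval s e2)%N
  | BRLe e1 e2 => reval s e1 <= reval s e2
  | BNot e1 => ~~ beval s e1
  | BAnd e1 e2 => beval s e1 && beval s e2
  end.

Fixpoint icost (e : iexp) : nat :=
  match e with
  | ICst _ => 1
  | IGet _ e1 => (icost e1).+1
  | IAdd e1 e2 | ISub e1 e2 => (icost e1 + icost e2).+1
  end.

Fixpoint rcost (e : rexp) : nat :=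
  match e with
  | RCst _ => 1
  | RGet _ e1 => (icost e1).+1
  | RAdd e1 e2 | RSub e1 e2 | RMul e1 e2 | RDiv e1 e2 =>
      (rcost e1 + rcost e2).+1
  end.

Fixpoint bcost (e : bexp) : nat :=
  match e with
  | BILe e1 e2 => (icost e1 + icost e2).+1
  | BRLe e1 e2 => (rcost e1 + rcost e2).+1
  | BNot e1 => (bcost e1).+1
  | BAnd e1 e2 => (bcost e1 + bcost e2).+1
  end.

(* run tab acc c s s' t: started in memory s, the program c halts in memory
   s' after time t.  A query returns an entry of [tab] in time acc, on top of
   the evaluation of its operands. *)
Inductive run (R : realType) (tab : seq nat -> R) (acc : nat) :
  cmd -> memory R -> memory R -> nat -> Prop :=
| run_skip s : run tab acc CSkip s s 1
| run_iset k e v s :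
    run tab acc (CISet k e v) s (set_i s k (ieval s e) (ieval s v))
      (icost e + icost v).+1
| run_rset k e v s :
    run tab acc (CRSet k e v) s (set_r s k (ieval s e) (reval s v))
      (icost e + rcost v).+1
| run_seq c1 c2 s s1 s2 t1 t2 :
    run tab acc c1 s s1 t1 -> run tab acc c2 s1 s2 t2 ->
    run tab acc (CSeq c1 c2) s s2 (t1 + t2).+1
| run_if_true b c1 c2 s s' t :
    beval s b -> run tab acc c1 s s' t ->
    run tab acc (CIf b c1 c2) s s' (bcost b + t).+1
| run_if_false b c1 c2 s s' t :
    ~~ beval s b -> run tab acc c2 s s' t ->
    run tab acc (CIf b c1 c2) s s' (bcost b + t).+1
| run_while_false b c s :
    ~~ beval s b -> run tab acc (CWhile b c) s s (bcost b).+1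
| run_while_true b c s s1 s2 t1 t2 :
    beval s b -> run tab acc c s s1 t1 ->
    run tab acc (CWhile b c) s1 s2 t2 ->
    run tab acc (CWhile b c) s s2 (bcost b + t1 + t2).+1
| run_query k e x l s :
    run tab acc (CQuery k e x l) s
      (set_r s k (ieval s e) (tab (mkseq (imem s x) (ieval s l))))
      (icost e + icost l + acc).+1.

Definition letter (A : finType) (c : A) : nat := enum_rank c.

(* The entries P(S <= n | X^n = x^n), 1 <= n <= kappa; the letters of x^n are
   numbered by [letter], and ill-formed requests return 0. *)
Definition S_list (R : realType) (d : measure_display) (Om : measurableType d)
  (P : probability Om R) (kappa : nat) (A : finType) (X : nat -> Om -> A)
  (S : Om -> nat) (s : seq nat) : R :=
  if (1 <= size s <= kappa)%N then
    cPr P [set w | (S w <= size s)%N]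
          (starts_with (fun i w => letter (X i w)) s)
  else 0.

(* Integer cell (0, 0) holds kappa, real cell (0, letter x * |B| + letter y)
   holds P(X = x, Y = y); all other cells hold 0. *)
Definition input (R : realType) (d : measure_display) (Om : measurableType d)
  (P : probability Om R) (kappa : nat) (A B : finType) (X : nat -> Om -> A)
  (Y : nat -> Om -> B) : memory R :=
  Memory
    (fun k i => if (k == 0%N) && (i == 0%N) then kappa else 0%N)
    (fun k i => if k == 0%N then
       \sum_(p : A * B | i == (letter p.1 * #|B| + letter p.2)%N)
          Pr P [set w | X 0%N w = p.1 /\ Y 0%N w = p.2]
     else 0).

(* The composition of y (number of occurrences of each letter), written in
   base kappa + 1. *)
Definition composition (kappa : nat) (A : finType) (y : seq A) : nat :=
  \sum_(c : A) (count_mem c y * kappa.+1 ^ letter c)%N.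

(* Memory s contains M in integer cell (1, 0), lambda_m in cell m of integer
   array 2 (flag for +oo) and real array 1 (value otherwise), alpha_m and d_m
   in cell m of real arrays 2 and 3, and the m-th tree in integer array 3, as
   a table telling, for each composition, whether the nodes with that
   composition are leaves; this determines the tree, whose root is the empty
   string. *)
Definition output (R : realType) (d : measure_display) (Om : measurableType d)
  (P : probability Om R) (kappa : nat) (A : finType) (Y : nat -> Om -> A)
  (S : Om -> nat) (M : nat) (s : memory R) : Prop :=
  [/\ imem s 1 0 = M,
      forall m, (m <= M)%N ->
        algo_lambda P kappa Y S m =
        (if imem s 2 m == 1%N then +oo%E else (rmem s 1 m)%:E),
      forall m, (1 <= m <= M)%N ->
        rmem s 2 m = algo_alpha P kappa Y S m /\
        rmem s 3 m = algo_d P kappa Y S m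
    & forall m (y : kappa.-bseq A), (m <= M)%N ->
        y \in algo_tree P kappa Y S m ->
        (y \in leaves (algo_tree P kappa Y S m)) =
        (imem s 3 (m * kappa.+1 ^ #|A| + composition kappa y) == 1%N)].

(* Main.v *)
(* Although b(y) depends on the order of the letters of y, the difference
   sum_c b(yc) - b(y) = P(S <= n, Y^n = y) depends only on the composition of y,
   just as a(y) does.  Hence so do a(T_y), b(T_y) - b(y) and g(y, T) for a tree
   T of the form {y : no strict prefix of y has a marked composition}, and
   pruning such a tree amounts to marking more compositions.  A round therefore
   reduces to a dynamic program over at most (kappa + 1)^|Y| compositions, and
   since each round marks a new one there are at most that many rounds.

   The values P(S <= n, Y^n = y) = sum_x P(S <= n | X^n = x) P(X^n = x, Y^n = y)
   are obtained by grouping the x of the same composition: the total weight of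
   those of composition u is the coefficient of Z^u in
   prod_i (sum_x P(X = x, Y = y_i) Z^((kappa + 1)^x)). *)
Require Import Defs.
From mathcomp Require Import all_boot all_order all_fingroup all_algebra.
From mathcomp Require Import all_classical all_reals all_analysis.
From mathcomp Require Import measurable_realfun zify.
Set Implicit Arguments.
Unset Strict Implicit.
Unset Printing Implicit Defensive.
Import Order.TTheory GRing.Theory Num.Theory.

Local Open Scope classical_set_scope.
Local Open Scope ring_scope.

(** * Execution within a time bound *)

(** Time and correctness are separated. Every loop is shown to make at most N = (kappa + 1)^(|X| +
    |Y| + 1) passes; the program being one text for given alphabets, its time is then at most a
    polynomial in N and the access time, with constants read off the text.

    Two orders on compositions drive a round. Appending a letter adds a power of kappa + 1, so a
    descending sweep meets children before parents and can sum over leaves, while an ascending sweep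
    meets parents before children and finds which compositions occur in the tree. The latter is
    needed because g is maximized over nodes only, whereas the tables are filled at every number
    below (kappa + 1)^|Y|, including numbers of strings that are too long or already pruned.

    As naturals have only addition and truncated subtraction, powers and decoding are obtained by
    repetition, and polynomials are stored shifted so that no index is truncated. An infinite g is
    carried by a flag beside a value set to 0, so that comparing such pairs compares the ratios. *)

Fixpoint untouched_i (k : nat) (c : cmd) : bool :=
  match c with
  | CSkip | CRSet _ _ _ | CQuery _ _ _ _ => true
  | CISet k' _ _ => k != k'
  | CSeq c1 c2 | CIf _ c1 c2 => untouched_i k c1 && untouched_i k c2
  | CWhile _ c1 => untouched_i k c1
  end.

Fixpoint untouched_r (k : nat) (c : cmd) : bool :=
  match c with
  | CSkip | CISet _ _ _ => true
  | CRSet k' _ _ | CQuery k' _ _ _ => k != k'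
  | CSeq c1 c2 | CIf _ c1 c2 => untouched_r k c1 && untouched_r k c2
  | CWhile _ c1 => untouched_r k c1
  end.

(** Which arrays a program may write is read off its text; [run_frame] turns this into preservation,
    so that the specifications below mention only the arrays that change. *)
Definition frame (R : Type) (c : cmd) (s s' : memory R) : Prop :=
  (forall k, untouched_i k c -> imem s' k = imem s k) /\
  (forall k, untouched_r k c -> rmem s' k = rmem s k).

Lemma frame_trans (R : Type) c (s1 s2 s3 : memory R) :
  frame c s1 s2 -> frame c s2 s3 -> frame c s1 s3.
Proof.
by move=> [i1 r1] [i2 r2]; split=> k hk; [rewrite i2// i1|rewrite r2// r1].
Qed.

Lemma frame_sub (R : Type) c c' (s s' : memory R) :
  (forall k, untouched_i k c -> untouched_i k c') ->
  (forall k, untouched_r k c -> untouched_r k c') ->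
  frame c' s s' -> frame c s s'.
Proof. by move=> hi hr [i r]; split=> k hk; [apply/i/hi|apply/r/hr]. Qed.

Lemma upd_neq (V : Type) (f : nat -> nat -> V) k i v k' :
  k' != k -> upd f k i v k' = f k'.
Proof. by move=> /negbTE h; apply/funext => j; rewrite /upd h. Qed.

Lemma frame_iset (R : Type) k e v (s : memory R) i w :
  frame (CISet k e v) s (set_i s k i w).
Proof. by split=> k' /= h //; apply: upd_neq. Qed.

Lemma frame_rset (R : Type) k e v (s : memory R) i w :
  frame (CRSet k e v) s (set_r s k i w).
Proof. by split=> k' /= h //; apply: upd_neq. Qed.

Lemma run_frame (R : realType) (tab : seq nat -> R) acc c s s' t :
  run tab acc c s s' t -> frame c s s'.
Proof.
elim=> {c s s' t} //=.
- by move=> k e v s; exact: frame_iset.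
- by move=> k e v s; exact: frame_rset.
- move=> c1 c2 s s1 s2 t1 t2 _ f1 _ f2; apply: (@frame_trans _ _ _ s1).
    by apply: frame_sub f1 => k /= /andP[].
  by apply: frame_sub f2 => k /= /andP[].
- by move=> s b c1 c2 s' t _ _ f; apply: frame_sub f => k /= /andP[].
- by move=> s b c1 c2 s' t _ _ f; apply: frame_sub f => k /= /andP[].
- move=> b c s s1 s2 t1 t2 _ _ f1 _ f2; exact: frame_trans f1 f2.
- by move=> k e x l s; exact: (frame_rset k e (RCst 0)).
Qed.

(* Bounds the running time as soon as no loop makes more than [N] iterations;
   [wp] below carries this bound along. *)
Fixpoint time_bound (N acc : nat) (c : cmd) : nat :=
  match c with
  | CSkip => 1
  | CISet _ e v => (icost e + icost v).+1
  | CRSet _ e v => (icost e + rcost v).+1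
  | CSeq c1 c2 => (time_bound N acc c1 + time_bound N acc c2).+1
  | CIf b c1 c2 => (bcost b + (time_bound N acc c1 + time_bound N acc c2)).+1
  | CWhile b c1 => (N * (bcost b + time_bound N acc c1).+1 + (bcost b).+1)%N
  | CQuery _ e _ l => (icost e + icost l + acc).+1
  end.

(** Each loop raises the exponent by one, and the other commands only add up. [C] and [k] depend on
    the text of the program alone. *)
Lemma time_bound_poly c :
  exists C k : nat, forall N acc, (time_bound N acc c <= C * (N + acc).+1 ^ k)%N.
Proof.
have cst n : (exists C k : nat, forall N acc : nat, n <= C * (N + acc).+1 ^ k)%N.
  by exists n, 0%N => N acc; rewrite expn0 muln1.
elim: c => [|k e v|k e v|c1 [C1 [k1 h1]] c2 [C2 [k2 h2]]
           |b c1 [C1 [k1 h1]] c2 [C2 [k2 h2]]|b c [C [k h]]|k e x l] /=;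
  try exact: cst.
- exists (C1 + C2).+1, (k1 + k2)%N => N acc.
  have := h1 N acc; have := h2 N acc; set B := (N + acc).+1 => H2 H1.
  (* Adding the exponents puts both powers of the positive [B] below a single one. *)
  have p1 : (B ^ k1 <= B ^ (k1 + k2))%N by rewrite leq_pexp2l // leq_addr.
  have p2 : (B ^ k2 <= B ^ (k1 + k2))%N by rewrite leq_pexp2l // leq_addl.
  have p3 : (0 < B ^ (k1 + k2))%N by rewrite expn_gt0.
  have := leq_mul (leqnn C1) p1; have := leq_mul (leqnn C2) p2; lia.
- exists (C1 + C2 + bcost b).+1, (k1 + k2)%N => N acc.
  have := h1 N acc; have := h2 N acc; set B := (N + acc).+1 => H2 H1.
  have p1 : (B ^ k1 <= B ^ (k1 + k2))%N by rewrite leq_pexp2l // leq_addr.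
  have p2 : (B ^ k2 <= B ^ (k1 + k2))%N by rewrite leq_pexp2l // leq_addl.
  have p3 : (0 < B ^ (k1 + k2))%N by rewrite expn_gt0.
  have := leq_mul (leqnn C1) p1; have := leq_mul (leqnn C2) p2.
  have := leq_mul (leqnn (bcost b)) p3; lia.
- exists (C + 2 * (bcost b).+1)%N, k.+1 => N acc.
  have := h N acc; set B := (N + acc).+1 => H.
  have p3 : (0 < B ^ k)%N by rewrite expn_gt0.
  have NB : (N <= B)%N by rewrite /B; lia.
  have -> : (B ^ k.+1 = B * B ^ k)%N by rewrite expnS.
  apply: (@leq_trans (B * (bcost b + C * B ^ k).+1 + (bcost b).+1)%N).
    by rewrite leq_add2r; apply: leq_mul => //; rewrite ltnS leq_add2l.
  move: p3; move: (B ^ k)%N => D p3; have B0 : (0 < B)%N by [].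
  have h1 : (B <= B * D)%N by rewrite leq_pmulr.
  have h2 := leq_mul (leqnn (bcost b).+1) h1.
  have h3 : (0 < B * D)%N by rewrite muln_gt0 B0.
  have h4 := leq_mul (leqnn (bcost b).+1) h3; nia.
- exists (icost e + icost l).+2, 1%N => N acc; rewrite expn1; nia.
Qed.

(** * Weakest preconditions with a time bound *)

Section Wp.
Variables (R : realType) (tab : seq nat -> R) (acc N : nat).
Implicit Types (s : memory R) (Q : memory R -> Prop).

(** Total correctness: the existence of the run includes termination. The time is compared with the
    bound read off the text, so that invariants never carry a clock. *)
Definition wp c Q s : Prop :=
  exists s' t, [/\ run tab acc c s s' t, (t <= time_bound N acc c)%N & Q s'].

Lemma wp_frame c Q s : wp c (fun s' => frame c s s' -> Q s') s -> wp c Q s.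
Proof.
move=> [s' [t [r ht h]]]; exists s', t; split => //; apply: h.
exact: run_frame r.
Qed.

Lemma wp_mono c Q Q' s : (forall s', frame c s s' -> Q s' -> Q' s') ->
  wp c Q s -> wp c Q' s.
Proof.
move=> h [s' [t [r ht q]]]; exists s', t; split => //; apply: h q.
exact: run_frame r.
Qed.

Lemma wp_skip Q s : Q s -> wp CSkip Q s.
Proof. by exists s, 1%N; split=> //; exact: run_skip. Qed.

Lemma wp_iset k e v Q s :
  Q (set_i s k (ieval s e) (ieval s v)) -> wp (CISet k e v) Q s.
Proof. by eexists; eexists; split; [exact: run_iset|by []|]. Qed.

Lemma wp_rset k e v Q s :
  Q (set_r s k (ieval s e) (reval s v)) -> wp (CRSet k e v) Q s.
Proof. by eexists; eexists; split; [exact: run_rset|by []|]. Qed.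

Lemma wp_query k e x l Q s :
  Q (set_r s k (ieval s e) (tab (mkseq (imem s x) (ieval s l)))) ->
  wp (CQuery k e x l) Q s.
Proof. by eexists; eexists; split; [exact: run_query|by []|]. Qed.

Lemma wp_seq c1 c2 Q s : wp c1 (wp c2 Q) s -> wp (CSeq c1 c2) Q s.
Proof.
move=> [s1 [t1 [r1 h1 [s2 [t2 [r2 h2 q]]]]]].
exists s2, (t1 + t2).+1; split => //; first exact: run_seq r1 r2.
by rewrite ltnS leq_add.
Qed.

Lemma wp_if b c1 c2 Q s : (beval s b -> wp c1 Q s) ->
  (~~ beval s b -> wp c2 Q s) -> wp (CIf b c1 c2) Q s.
Proof.
case: (boolP (beval s b)) => hb h1 h2.
  have [s' [t [r ht q]]] := h1 isT.
  exists s', (bcost b + t).+1; split => //; first exact: run_if_true.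
  by rewrite /= ltnS leq_add2l (leq_trans ht) // leq_addr.
have [s' [t [r ht q]]] := h2 isT.
exists s', (bcost b + t).+1; split => //; first exact: run_if_false.
by rewrite /= ltnS leq_add2l (leq_trans ht) // leq_addl.
Qed.

(** [I] is indexed by the number of completed passes. Proving [j < N] whenever the test succeeds
    gives at once termination and the factor [N] of [time_bound]. *)
Lemma wp_while (I : nat -> memory R -> Prop) b c Q s :
  I 0%N s ->
  (forall j s', frame (CWhile b c) s s' -> beval s' b -> I j s' ->
     (j < N)%N /\ wp c (I j.+1) s') ->
  (forall j s', frame (CWhile b c) s s' -> ~~ beval s' b -> I j s' -> Q s') ->
  wp (CWhile b c) Q s.
Proof.
move=> I0 step fin.
(* Induction on the number [n] of passes still allowed, with [n] in place of [N] in the bound. *)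
suff H n j s' : (n + j = N)%N -> frame (CWhile b c) s s' -> I j s' ->
    exists s2 t, [/\ run tab acc (CWhile b c) s' s2 t,
      (t <= n * (bcost b + time_bound N acc c).+1 + (bcost b).+1)%N & Q s2].
  by have [//|s2 [t [r ht q]]] := H N 0%N s (addn0 _) _ I0; exists s2, t.
elim: n j s' => [|n IH] j s' nj f Ij.
  case: (boolP (beval s' b)) => hb.
    by have [] := step _ _ f hb Ij; rewrite -nj add0n ltnn.
  exists s', (bcost b).+1; split => //; first exact: run_while_false.
  exact: fin f hb Ij.
case: (boolP (beval s' b)) => hb; last first.
  exists s', (bcost b).+1; split; [exact: run_while_false|exact: leq_addl|].
  exact: fin f hb Ij.
have [_ [s1 [t1 [r1 h1 I1]]]] := step _ _ f hb Ij.
have f1 : frame (CWhile b c) s' s1.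
  by have := run_frame r1; exact: frame_sub.
have nj1 : (n + j.+1 = N)%N by lia.
have [s2 [t2 [r2 h2 q]]] := IH _ _ nj1 (frame_trans f f1) I1.
exists s2, (bcost b + t1 + t2).+1; split => //.
  exact: run_while_true r1 r2.
by rewrite mulSn; lia.
Qed.

End Wp.

(** * Counted loops and repetitions over letters *)

Definition IVar (k : nat) : iexp := IGet k (ICst 0).
Definition assign (k : nat) (e : iexp) : cmd := CISet k (ICst 0) e.
Definition CFor (k : nat) (e : iexp) (c : cmd) : cmd :=
  CSeq (assign k (ICst 0))
    (CWhile (BILe (IAdd (IVar k) (ICst 1)) e)
       (CSeq c (assign k (IAdd (IVar k) (ICst 1))))).

(** Alphabet sizes are fixed with the program, so a repetition over letters is unrolled into its
    text, where [i] is a literal. *)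
Fixpoint CSeqs (n : nat) (f : nat -> cmd) : cmd :=
  if n is m.+1 then CSeq (CSeqs m f) (f m) else CSkip.

Fixpoint RSum (n : nat) (f : nat -> rexp) : rexp :=
  if n is m.+1 then RAdd (RSum m f) (f m) else RCst 0.

Lemma reval_RSum (R : realType) (s : memory R) n f :
  reval s (RSum n f) = \sum_(i < n) reval s (f i).
Proof. by elim: n => [|n IH] /=; rewrite ?big_ord0 // big_ord_recr IH. Qed.

Lemma untouched_i_CSeqs k n f :
  (forall i, untouched_i k (f i)) -> untouched_i k (CSeqs n f).
Proof. by move=> h; elim: n => //= n ->; rewrite h. Qed.

Lemma untouched_r_CSeqs k n f :
  (forall i, untouched_r k (f i)) -> untouched_r k (CSeqs n f).
Proof. by move=> h; elim: n => //= n ->; rewrite h. Qed.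

Section LoopRules.
Variables (R : realType) (tab : seq nat -> R) (acc N : nat).
Implicit Types (s : memory R) (Q : memory R -> Prop).
Local Notation wp := (@wp R tab acc N).

(** The bound [e] is evaluated again before each pass, hence the hypothesis on its value in every
    memory allowed by the frame. The body is specified up to the increment of the counter that
    follows it. *)
Lemma wp_for (I : nat -> memory R -> Prop) k e c n Q s :
  (n <= N)%N -> untouched_i k c ->
  (forall s', frame (CFor k e c) s s' -> ieval s' e = n) ->
  I 0%N (set_i s k 0 0) ->
  (forall j s', (j < n)%N -> frame (CFor k e c) s s' -> imem s' k 0 = j ->
     I j s' -> wp c (fun s2 => I j.+1 (set_i s2 k 0 j.+1)) s') ->
  (forall s', frame (CFor k e c) s s' -> I n s' -> Q s') ->
  wp (CFor k e c) Q s.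
Proof.
move=> nN kc en I0 step fin; apply/wp_seq/wp_iset => /=.
set s0 := set_i _ _ _ _.
have f0 : frame (CFor k e c) s s0.
  by apply: frame_sub (frame_iset k (ICst 0) (ICst 0) s 0 0) => k' /=; do ?by case/andP.
have ff s' : frame (CWhile (BILe (IAdd (IVar k) (ICst 1)) e)
       (CSeq c (assign k (IAdd (IVar k) (ICst 1))))) s0 s' ->
       frame (CFor k e c) s s'.
  by move=> f; apply: frame_trans f0 _; apply: frame_sub f => k' /=; first by case/andP.
apply: (wp_while (I := fun j s' => [/\ imem s' k 0 = j, (j <= n)%N & I j s'])).
- by split => //; rewrite /s0 /= /upd !eqxx.
- move=> j s' /ff f; rewrite /= en // => + [kj jn Ij]; rewrite kj addn1 => ltj.
  split; first exact: leq_trans ltj nN.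
  apply: wp_seq; apply: wp_mono (step _ _ ltj f kj Ij) => s2 [f2 _] I2.
  by apply: wp_iset => /=; rewrite f2 // kj addn1; split => //; rewrite /upd !eqxx.
- move=> j s' /ff f; rewrite /= en // => + [kj jn Ij]; rewrite kj addn1 -leqNgt.
  by move=> nj; apply: fin => //; rewrite (_ : n = j) //; apply/eqP; rewrite eqn_leq nj.
Qed.

Lemma wp_seqs (I : nat -> memory R -> Prop) n f Q s :
  I 0%N s ->
  (forall j s', (j < n)%N -> frame (CSeqs n f) s s' -> I j s' ->
     wp (f j) (I j.+1) s') ->
  (forall s', frame (CSeqs n f) s s' -> I n s' -> Q s') ->
  wp (CSeqs n f) Q s.
Proof.
elim: n Q => [|n IH] Q I0 step fin /=.
  by apply: wp_skip; apply: fin.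
apply: wp_seq; apply: IH => //.
  move=> j s' jn fr Ij; apply: step => //; first exact: ltnW.
  by apply: frame_sub fr => k /= /andP[].
move=> s' fr In.
have fr' : frame (CSeqs n.+1 f) s s' by apply: frame_sub fr => k /= /andP[].
apply: wp_mono (step n s' (ltnSn n) fr' In) => s2 fr2 I2; apply: fin => //.
by apply: frame_trans fr' _; apply: frame_sub fr2 => k /= /andP[].
Qed.

End LoopRules.

(** * Strings and their compositions *)

(** As long as multiplicities stay below [K] there are no carries: the digit at position i is the
    multiplicity of i, and [num_inj] recovers [s] up to permutation. *)
Definition num (K : nat) (s : seq nat) : nat := (\sum_(i <- s) K ^ i)%N.

Lemma num_cat K s t : num K (s ++ t) = (num K s + num K t)%N.
Proof. by rewrite /num big_cat. Qed.

Lemma num_rcons K s i : num K (rcons s i) = (num K s + K ^ i)%N.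
Proof. by rewrite -cats1 num_cat /num big_seq1. Qed.

Lemma size_le_num K s : (0 < K)%N -> (size s <= num K s)%N.
Proof.
move=> K0; rewrite /num; elim: s => [|i s IH]; first by rewrite big_nil.
by rewrite big_cons /= -add1n leq_add // expn_gt0 K0.
Qed.

Lemma num_count K n s : all (gtn n) s ->
  num K s = (\sum_(i < n) count_mem (i : nat) s * K ^ i)%N.
Proof.
rewrite /num; elim: s => [|j s IH] /=.
  by rewrite big_nil big1 // => i _; rewrite mul0n.
move=> /andP[jn /IH sn]; rewrite big_cons sn.
under [RHS]eq_bigr do rewrite mulnDl.
rewrite big_split /=; congr addn.
rewrite (bigD1 (Ordinal jn)) //= eqxx mul1n big1 ?addn0 // => i /negbTE.
by rewrite eq_sym => h; rewrite (_ : (j == i) = (Ordinal jn == i)) // h.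
Qed.

Lemma digits_lt K n (f : nat -> nat) : (forall i, (i < n)%N -> (f i < K)%N) ->
  (\sum_(i < n) f i * K ^ i < K ^ n)%N.
Proof.
elim: n => [|n IH] h; first by rewrite big_ord0.
rewrite big_ord_recr /= expnS.
have h1 : (\sum_(i < n) f i * K ^ i < K ^ n)%N.
  by apply: IH => i /ltnW; exact: h.
have h2 : (f n < K)%N by apply: h.
by apply: leq_trans (leq_mul h2 (leqnn (K ^ n))); rewrite mulSn -addSn leq_add2r.
Qed.

Lemma digits_inj K n (f g : nat -> nat) :
  (forall i, (i < n)%N -> (f i < K)%N) -> (forall i, (i < n)%N -> (g i < K)%N) ->
  (\sum_(i < n) f i * K ^ i = \sum_(i < n) g i * K ^ i)%N ->
  forall i, (i < n)%N -> f i = g i.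
Proof.
elim: n => [|n IH] // hf hg.
rewrite !big_ord_recr /=.
have hf' i : (i < n)%N -> (f i < K)%N by move=> /ltnW; exact: hf.
have hg' i : (i < n)%N -> (g i < K)%N by move=> /ltnW; exact: hg.
have lf := digits_lt hf'; have lg := digits_lt hg'.
have K0 : (0 < K ^ n)%N by apply: leq_ltn_trans lf.
move=> e.
(* The lower digits sum to less than [K ^ n], so division by it isolates the top digit. *)
have en : f n = g n.
  have := congr1 (divn^~ (K ^ n)%N) e.
  by rewrite /= !divnDMl // !divn_small.
move: e; rewrite en => /addIn e i; rewrite ltnS leq_eqVlt => /predU1P[->//|].
exact: IH.
Qed.

Lemma num_lt K n s : all (gtn n) s ->
  (forall i, (i < n)%N -> (count_mem i s < K)%N) -> (num K s < K ^ n)%N.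
Proof.
by move=> sn h; rewrite (num_count _ sn); exact: (@digits_lt _ _ (fun i => count_mem i s)).
Qed.

Lemma num_inj K n s t : all (gtn n) s -> all (gtn n) t ->
  (forall i, (i < n)%N -> (count_mem i s < K)%N) ->
  (forall i, (i < n)%N -> (count_mem i t < K)%N) ->
  num K s = num K t -> perm_eq s t.
Proof.
move=> sn tn hs ht; rewrite (num_count _ sn) (num_count _ tn) => e.
have H := @digits_inj _ _ (fun i => count_mem i s) (fun i => count_mem i t) hs ht e.
apply/allP => i _ /=; apply/eqP; have [/H//|ni] := ltnP i n.
have z u : all (gtn n) u -> count_mem i u = 0%N.
  move=> un; apply/count_memPn/negP => /(allP un) /=; by rewrite ltnNge ni.
by rewrite !z.
Qed.

Lemma count_lt (T : eqType) K (s : seq T) x : (size s < K)%N -> (count_mem x s < K)%N.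
Proof. exact/leq_ltn_trans/count_size. Qed.

Section Composition.
Variable A : finType.
Implicit Types (y : seq A) (kappa : nat).

Lemma letter_lt (c : A) : (letter c < #|A|)%N.
Proof. by rewrite /letter ltn_ord. Qed.

Lemma letter_inj : injective (@letter A).
Proof. by move=> a b /ord_inj/enum_rank_inj. Qed.

Lemma all_letter y : all (gtn #|A|) (map (@letter A) y).
Proof. by apply/allP => _ /mapP[c _ ->] /=; exact: letter_lt. Qed.

Lemma letter_surj (s : seq nat) : all (gtn #|A|) s ->
  exists y : seq A, map (@letter A) y = s.
Proof.
elim: s => [|i s IH] /=; first by exists [::].
move=> /andP[ni /IH[y <-]]; exists (enum_val (Ordinal ni) :: y) => /=.
by rewrite /letter enum_valK.
Qed.

Lemma compositionE kappa y : composition kappa y = num kappa.+1 (map (@letter A) y).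
Proof.
rewrite /composition /num big_map; elim: y => [|a y IH].
  by rewrite big_nil big1 // => c _; rewrite mul0n.
rewrite big_cons -IH; under eq_bigr do rewrite /= mulnDl.
rewrite big_split /=; congr addn.
rewrite (bigD1 a) //= eqxx mul1n big1 ?addn0 // => c /negbTE.
by rewrite eq_sym => ->.
Qed.

Lemma composition_rcons kappa y c :
  composition kappa (rcons y c) = (composition kappa y + kappa.+1 ^ letter c)%N.
Proof. by rewrite !compositionE map_rcons num_rcons. Qed.

Lemma composition_nil kappa : composition kappa ([::] : seq A) = 0%N.
Proof. by rewrite compositionE /num big_nil. Qed.

Lemma composition_lt kappa y : (size y <= kappa)%N ->
  (composition kappa y < kappa.+1 ^ #|A|)%N.
Proof.
move=> h; rewrite compositionE; apply: num_lt; first exact: all_letter.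
by move=> i _; apply: count_lt; rewrite size_map.
Qed.

Lemma perm_letter y y' : perm_eq (map (@letter A) y) (map (@letter A) y') ->
  perm_eq y y'.
Proof.
move=> h; apply/allP => c _ /=; apply/eqP.
have cm z : count_mem (letter c) (map (@letter A) z) = count_mem c z.
  by rewrite count_map; apply: eq_count => b /=; rewrite (inj_eq letter_inj).
by rewrite -!cm; move/seq.permP: h; exact.
Qed.

(** Only [y] has a bounded length: of [s], a string found by decoding, one merely knows that each
    multiplicity is a digit. Uniqueness of digits forces equal multiplicities. *)
Lemma perm_composition kappa y s : (size y <= kappa)%N -> all (gtn #|A|) s ->
  (forall i, (i < #|A|)%N -> (count_mem i s <= kappa)%N) ->
  num kappa.+1 s = composition kappa y -> perm_eq s (map (@letter A) y).
Proof.
move=> sy sA cs; rewrite compositionE; apply: (@num_inj _ #|A|) => //.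
  exact: all_letter.
by move=> i _; apply: count_lt; rewrite size_map.
Qed.

End Composition.

(** * Trees cut by a stopping rule *)

Section Tree.
Variables (kappa : nat) (A : finType) (a0 : A).
Implicit Types (y z : seq A) (T : {set kappa.-bseq A}) (stop : pred (seq A)).

(** Only strict prefixes are tested: a stopped node still belongs to the tree, as a leaf. *)
Definition reached stop y : bool :=
  all (fun n => ~~ stop (take n y)) (iota 0 (size y)).

Lemma reachedP stop y :
  reflect (forall n, (n < size y)%N -> ~~ stop (take n y)) (reached stop y).
Proof.
apply: (iffP allP) => h n; first by move=> ny; apply: h; rewrite mem_iota.
by rewrite mem_iota /= add0n; exact: h.
Qed.

Lemma reached_rcons stop y c :
  reached stop (rcons y c) = reached stop y && ~~ stop y.
Proof.
rewrite /reached size_rcons -addn1 iotaD all_cat /= andbT add0n -cats1 take_size_cat //.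
congr andb; apply: eq_in_all => n; rewrite mem_iota /= add0n => ny.
by rewrite takel_cat // ltnW.
Qed.

Definition cut_tree stop : {set kappa.-bseq A} :=
  [set y : kappa.-bseq A | reached stop y]%SET.

(** Falls back to the empty string when there is no room for a letter; [extE] excludes this case. *)
Definition ext (y : seq A) (c : A) : kappa.-bseq A := insub_bseq kappa (rcons y c).

Lemma extE y c : (size y < kappa)%N -> ext y c = rcons y c :> seq A.
Proof. by move=> h; rewrite /ext /insub_bseq insubdK // -topredE /= size_rcons. Qed.

Variable stop : pred (seq A).
Hypothesis stopk : forall y, size y = kappa -> stop y.

Let T := cut_tree stop.

Lemma size_go (y : kappa.-bseq A) : ~~ stop y -> (size y < kappa)%N.
Proof.
move=> ns; rewrite ltn_neqAle size_bseq andbT; apply: contraNN ns => /eqP.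
exact: stopk.
Qed.

(** By [stopk] a node that is not stopped is shorter than [kappa], so its child by [a0] belongs to
    the tree. *)
Lemma leaves_cut (y : kappa.-bseq A) : (y \in leaves T) = (y \in T) && stop y.
Proof.
rewrite inE /is_leaf; case: (boolP (y \in T)) => //= yT.
apply/forall_inP/idP => [h|sy z].
  apply/negPn/negP => ns; have := size_go ns => sy.
  have := h (ext y a0); rewrite inE extE // reached_rcons ns andbT.
  rewrite inE in yT; rewrite yT => /(_ isT) /negP; apply.
  by apply/existsP; exists a0.
rewrite inE => zT; apply/negP => /existsP[c /eqP zc].
by move: zT; rewrite zc reached_rcons sy andbF.
Qed.

Lemma internal_cut (y : kappa.-bseq A) : (y \in internal T) = (y \in T) && ~~ stop y.
Proof. by rewrite finset.in_setD leaves_cut; case: (y \in T); rewrite ?andbT. Qed.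

Lemma ext_cut (y : kappa.-bseq A) c :
  y \in internal T -> ext y c \in T /\ ext y c = rcons y c :> seq A.
Proof.
rewrite internal_cut => /andP[yT ns]; have sy := size_go ns.
by rewrite inE extE // reached_rcons ns; rewrite inE in yT; rewrite yT.
Qed.

Lemma in_subtree_leaves (T' : {set kappa.-bseq A}) (y z : kappa.-bseq A) :
  (z \in subtree_leaves T' y) = (z \in leaves T') && prefix y z.
Proof. by rewrite /subtree_leaves finset.in_set. Qed.

Lemma subtree_leaves_stop (y : kappa.-bseq A) : y \in leaves T ->
  subtree_leaves T y = [set y]%SET.
Proof.
move=> yl; apply/finset.setP => z; rewrite finset.in_set1 in_subtree_leaves.
apply/andP/eqP => [[zl /prefixP[u zu]]|->]; last by rewrite yl prefix_refl.
apply/val_inj => /=; rewrite zu; case: u zu => [|c u] zu; first by rewrite cats0.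
move: zl yl; rewrite !leaves_cut !inE => /andP[/reachedP/(_ (size y)) zr _] /andP[_ sy].
by move: zr; rewrite zu take_size_cat // sy size_cat /= => /(_ _)/negP[]//; lia.
Qed.

(** Leaves below an internal node are strictly longer than it, and are sorted by the letter that
    follows [y]. *)
Lemma subtree_leaves_go (V : nmodType) (F : kappa.-bseq A -> V) (y : kappa.-bseq A) :
  y \in internal T ->
  \sum_(z in subtree_leaves T y) F z =
  \sum_c \sum_(z in subtree_leaves T (ext y c)) F z.
Proof.
move=> yi; have := yi; rewrite internal_cut => /andP[yT ns].
rewrite (partition_big (fun z : kappa.-bseq A => nth a0 z (size y)) predT) //=.
apply: eq_bigr => c _; apply: eq_bigl => z.
have [_ e] := ext_cut c yi; rewrite !in_subtree_leaves.
case zl : (z \in leaves T) => //=; rewrite !prefixE e size_rcons.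
(* A leaf no longer than [y] extends neither [y], which is not a leaf, nor its child. *)
have [zy|yz] := leqP (size z) (size y).
  rewrite !take_oversize //; last by apply: leq_trans zy _.
  have zny : (z : seq A) <> y.
    by move=> zy'; move: zl; rewrite leaves_cut zy' (negbTE ns) andbF.
  rewrite [in RHS](_ : _ == _ = false); first by case: eqP.
  by apply/negbTE/eqP => zc; move: zy; rewrite zc size_rcons ltnn.
by rewrite (take_nth a0 yz) eqseq_rcons.
Qed.

Lemma nil_cut : [bseq] \in T.
Proof. by rewrite inE. Qed.

Lemma leaves_subtree : leaves T = subtree_leaves T [bseq].
Proof. by apply/finset.setP => z; rewrite in_subtree_leaves prefix0s andbT. Qed.

Lemma take_cut (z : kappa.-bseq A) n : z \in T ->
  exists2 y : kappa.-bseq A, y = take n z :> seq A & y \in T.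
Proof.
rewrite inE => /reachedP zr.
have sy : (size (take n z) <= kappa)%N.
  by rewrite (leq_trans _ (size_bseq z)) // size_take_min geq_minr.
exists (Bseq sy) => //; rewrite inE /=; apply/reachedP => k.
rewrite size_take_min leq_min => /andP[kn kz]; rewrite take_takel ?zr //; exact: ltnW.
Qed.

(** Removing the strict descendants of the cut nodes means forbidding cut nodes as strict prefixes.
    The two rules are compared on nodes of the tree only: what lies beyond a stopped node is
    excluded by that node already. *)
Lemma prune_cut (stop' : pred (seq A)) (cut : pred (kappa.-bseq A)) :
  (forall y : kappa.-bseq A, y \in T -> stop y -> stop' y) ->
  (forall y : kappa.-bseq A, y \in internal T -> stop' y = cut y) ->
  T :\: (\bigcup_(y in internal T | cut y) strict_descendants T y)%SET =
  cut_tree stop'.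
Proof.
move=> hs hc; apply/finset.setP => z; rewrite finset.in_setD [in RHS]inE.
apply/andP/idP => [[/finset.bigcupP nz zT]|zr'].
  apply/reachedP => n nz'; have [y yE yT] := take_cut n zT.
  have sy : size y = n by rewrite yE size_takel // ltnW.
  have yi : y \in internal T.
    rewrite internal_cut yT /= yE; move: zT; rewrite inE => /reachedP; exact.
  rewrite -yE hc //; apply/negP => cy; apply: nz; exists y; first by rewrite yi cy.
  rewrite inE zT yE prefix_take /=; apply: contraTneq nz' => ->.
  by rewrite sy ltnn.
(* Strong induction on the length of a prefix: a shortest prefix stopped by the old rule would be a
   node, hence stopped by the new rule too. *)
have zT : z \in T.
  rewrite inE; apply/reachedP => n; elim/ltn_ind: n => n IH nz.
  have sy : (size (take n z) <= kappa)%N.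
    by rewrite size_takel ?(leq_trans (ltnW nz)) // size_bseq.
  have yT : Bseq sy \in T.
    rewrite inE /=; apply/reachedP => k; rewrite size_takel; last exact: ltnW.
    by move=> kn; rewrite take_takel ?(ltnW kn) // IH // (ltn_trans kn).
  apply/negP => sn; move/reachedP: zr' => /(_ _ nz) /negP; apply.
  exact: (hs (Bseq sy)).
split => //; apply/negP => /finset.bigcupP[y /andP[yi cy]].
rewrite inE => /and3P[_ /prefixP[u zu] zy].
case: u zu => [|c u] zu; first by case/negP: zy; rewrite -val_eqE /= zu cats0.
move/reachedP: zr' => /(_ (size y)); rewrite zu take_size_cat // hc // cy size_cat /=.
by move=> /(_ _)/negP[]//; lia.
Qed.

End Tree.

(** * Probabilities of strings *)

Section Probability.
Variables (R : realType) (d : measure_display) (Om : measurableType d).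
Variable P : probability Om R.
Implicit Types (E D : set Om).

Lemma PrE E : measurable E -> P E = (Pr P E)%:E.
Proof. by move=> mE; rewrite /Pr fineK // fin_num_measure. Qed.

(** The common source of finite partitions and of expectations of positive parts: both come from
    writing an integer-valued function as a finite sum of indicators. *)
Lemma integral_indic_sum (I : finType) (E : I -> set Om) D (f : Om -> R) :
  measurable D -> (forall i, measurable (E i)) ->
  (forall w, D w -> f w = \sum_i \1_(E i) w) ->
  (\int[P]_(w in D) (f w)%:E)%E = (\sum_i Pr P (E i `&` D))%:E.
Proof.
move=> mD mE fE.
under eq_integral => w /[!inE] wD do rewrite fE // -sumEFin.
rewrite ge0_integral_sum //.
- rewrite -sumEFin; apply: eq_bigr => i _.
  by rewrite integral_indic //; apply: PrE; exact: measurableI.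
- by move=> i; apply/measurable_EFinP; exact: measurable_indic.
Qed.

Lemma Pr_sum_eq (I J : finType) (E : I -> set Om) (F : J -> set Om) :
  (forall i, measurable (E i)) -> (forall j, measurable (F j)) ->
  (forall w, \sum_i \1_(E i) w = \sum_j \1_(F j) w :> R) ->
  \sum_i Pr P (E i) = \sum_j Pr P (F j).
Proof.
move=> mE mF EF.
have h := @integral_indic_sum _ E setT _ measurableT mE (fun w _ => erefl).
have := @integral_indic_sum _ F setT _ measurableT mF (fun w _ => EF w).
rewrite h => -[]; under eq_bigr do rewrite setIT.
by under [X in _ = X -> _]eq_bigr do rewrite setIT.
Qed.

(** The indicators of the pieces sum to that of [D]. Pieces may be empty, so that a partition can be
    indexed by a whole type. *)
Lemma Pr_partition (I : finType) (E : I -> set Om) D :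
  (forall i, measurable (E i)) ->
  (forall w, D w -> exists2 i, E i w & forall j, E j w -> j = i) ->
  (forall i w, E i w -> D w) ->
  Pr P D = \sum_i Pr P (E i).
Proof.
move=> mE h1 h2.
have mD : measurable D.
  rewrite (_ : D = \bigcup_i E i); first exact: fin_bigcup_measurable.
  by apply/seteqP; split => [w /h1[i]|w [i _ /h2]//]; exists i.
have -> : Pr P D = \sum_(i < 1) Pr P D by rewrite big_ord1.
apply: (@Pr_sum_eq _ _ (fun=> D)) => // w; rewrite big_ord1 indicE.
case: (boolP (w \in D)) => wD; last first.
  rewrite big1 // => i _; rewrite indicE memNset // => /h2 Dw.
  by move: wD; rewrite mem_set.
have [i Ei u] := h1 w (set_mem wD).
rewrite (bigD1 i) //= indicE mem_set // big1 ?addr0 // => j ji.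
by rewrite indicE memNset // => /u /eqP; rewrite (negbTE ji).
Qed.

Lemma Pr_set0 : Pr P set0 = 0.
Proof. by rewrite /Pr measure0. Qed.

Lemma Pr_setT : Pr P setT = 1.
Proof. by rewrite /Pr probability_setT. Qed.

Lemma Pr_ge0 E : 0 <= Pr P E.
Proof. by rewrite /Pr fine_ge0. Qed.

Lemma Pr_le D E : measurable D -> measurable E -> D `<=` E -> Pr P D <= Pr P E.
Proof.
by move=> mD mE DE; rewrite -lee_fin -!PrE //; apply: le_measure; rewrite ?inE.
Qed.

Lemma Pr_setI0 D E : measurable D -> measurable E -> Pr P E = 0 ->
  Pr P (D `&` E) = 0.
Proof.
move=> mD mE E0; apply/eqP; rewrite eq_le Pr_ge0 -[X in _ <= X]E0 andbT.
by apply: Pr_le => //; exact: measurableI.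
Qed.

(** On a null [E] both sides vanish, which spares the callers a case distinction. *)
Lemma Pr_cPr D E : measurable D -> measurable E ->
  Pr P E * cPr P D E = Pr P (D `&` E).
Proof.
move=> mD mE; rewrite /cPr mulrCA; have [E0|E0] := eqVneq (Pr P E) 0.
  by rewrite E0 mul0r mulr0 Pr_setI0.
by rewrite divff // mulr1.
Qed.

Lemma measurable_preimage (A : countType) (Z : Om -> A) (B : set A) :
  discrete_rv Z -> measurable (Z @^-1` B).
Proof.
move=> mZ; rewrite (_ : _ @^-1` _ =
    \bigcup_n (if unpickle n is Some z then
                 if z \in B then Z @^-1` [set z] else set0 else set0)).
  apply: bigcupT_measurable => n.
  by case: unpickle => // z; case: ifP => // _; exact: mZ.
apply/seteqP; split => [w Bw|w [n _]].
  by exists (pickle (Z w)) => //; rewrite pickleK mem_set.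
by case: unpickle => // z; case: ifPn => // /[!inE] Bz /= ->.
Qed.

Lemma discrete_comp (A B : countType) (Z : Om -> A) (f : A -> B) :
  discrete_rv Z -> discrete_rv (f \o Z).
Proof.
by move=> mZ z; exact: (@measurable_preimage _ Z (f @^-1` [set z])).
Qed.

Lemma starts_withE (A : Type) (Z : nat -> Om -> A) (a0 : A) (s : seq A) :
  starts_with Z s = [set w | forall i, (i < size s)%N -> Z i w = nth a0 s i].
Proof.
apply/seteqP; split => [w /= e i si|w /= e].
  by rewrite -[in RHS]e nth_mkseq.
apply: (@eq_from_nth _ a0) => [|i]; rewrite size_mkseq // => si.
by rewrite nth_mkseq // e.
Qed.

Lemma starts_with_rcons (A : Type) (Z : nat -> Om -> A) (s : seq A) (c : A) :
  starts_with Z (rcons s c) = starts_with Z s `&` Z (size s) @^-1` [set c].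
Proof.
have mk w : mkseq (Z^~ w) (size s).+1 = rcons (mkseq (Z^~ w) (size s)) (Z (size s) w).
  by rewrite /mkseq -[X in iota 0 X]addn1 iotaD map_cat /= add0n cats1.
apply/seteqP; split => w /=; rewrite /starts_with /= size_rcons mk.
  by move=> /rcons_inj[-> ->].
by move=> [-> ->].
Qed.

Lemma starts_with_nil (A : Type) (Z : nat -> Om -> A) : starts_with Z [::] = setT.
Proof. by apply/seteqP; split. Qed.

Lemma measurable_starts_with (A : Type) (Z : nat -> Om -> A) (s : seq A) :
  (forall i, discrete_rv (Z i)) -> measurable (starts_with Z s).
Proof.
move=> mZ; elim/last_ind: s => [|s c IH]; first by rewrite starts_with_nil.
by rewrite starts_with_rcons; apply: measurableI => //; exact: mZ.
Qed.

Lemma starts_with_map (A B : Type) (f : A -> B) (Z : nat -> Om -> A) (s : seq A) :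
  injective f -> starts_with (fun i w => f (Z i w)) (map f s) = starts_with Z s.
Proof.
have mk w n : mkseq (fun i => f (Z i w)) n = map f (mkseq (Z^~ w) n).
  by rewrite /mkseq -map_comp.
move=> fi; apply/seteqP; split => w; rewrite /starts_with /= size_map mk.
  exact: (inj_map fi).
by move=> ->.
Qed.

End Probability.

(** * Joint law of the two processes and of the stopping time *)

Section Process.
Variables (R : realType) (d : measure_display) (Om : measurableType d).
Variables (P : probability Om R) (XT YT : finType).
Variables (X : nat -> Om -> XT) (Y : nat -> Om -> YT) (S : Om -> nat) (kappa : nat).
Hypothesis XYiid : iid P (fun i w => (X i w, Y i w)).
Hypothesis Sdisc : discrete_rv S.

Let joint (x : XT) (y : YT) : R := Pr P [set w | X 0%N w = x /\ Y 0%N w = y].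

Lemma discrete_X i : discrete_rv (X i).
Proof. by case: XYiid => + _ _ => /(_ i) /(@discrete_comp _ _ _ _ _ fst). Qed.

Lemma discrete_Y i : discrete_rv (Y i).
Proof. by case: XYiid => + _ _ => /(_ i) /(@discrete_comp _ _ _ _ _ snd). Qed.

Lemma measurable_X x : measurable (starts_with X x).
Proof. exact/measurable_starts_with/discrete_X. Qed.

Lemma measurable_Y y : measurable (starts_with Y y).
Proof. exact/measurable_starts_with/discrete_Y. Qed.

Lemma measurable_S (B : set nat) : measurable (S @^-1` B).
Proof. exact: measurable_preimage. Qed.

Lemma measurable_Sle n : measurable [set w | (S w <= n)%N].
Proof. exact: (@measurable_S [set m | (m <= n)%N]). Qed.

Lemma measurable_Sgt n : measurable [set w | (n < S w)%N].
Proof. exact: (@measurable_S [set m | (n < m)%N]). Qed.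

Hint Resolve measurable_X measurable_Y measurable_Sle measurable_Sgt : core.

Lemma Pr_joint (x : seq XT) (y : seq YT) : size x = size y ->
  Pr P (starts_with X x `&` starts_with Y y) =
  \prod_(l <- zip x y) joint l.1 l.2.
Proof.
move=> xy; have [_ pr st] := XYiid.
have -> : starts_with X x `&` starts_with Y y =
    starts_with (fun i w => (X i w, Y i w)) (zip x y).
  have e w n : mkseq (fun i => (X i w, Y i w)) n =
      zip (mkseq (X^~ w) n) (mkseq (Y^~ w) n).
    by rewrite /mkseq zip_map.
  apply/seteqP; split => w; rewrite /starts_with /= size_zip -xy minnn e.
    by move=> [-> ->].
  move=> h; split.
    by rewrite -(unzip1_zip (eq_leq xy)) -h unzip1_zip ?size_mkseq.
  by rewrite -(unzip2_zip (eq_leq (esym xy))) -h unzip2_zip ?size_mkseq // size_mkseq xy.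
case: (zip x y) => [|z0 z]; first by rewrite big_nil starts_with_nil Pr_setT.
have -> : starts_with (fun i w => (X i w, Y i w)) (z0 :: z) =
  cylinder (fun i w => (X i w, Y i w)) (iota 0 (size (z0 :: z)))
    (fun i => [set nth z0 (z0 :: z) i]).
  rewrite (starts_withE _ z0); apply/seteqP; split => w h i.
    by rewrite mem_iota => iz; exact: h.
  by move=> iz; apply: h; rewrite mem_iota.
rewrite pr ?iota_uniq // (big_nth z0) /index_iota subn0; apply: eq_bigr => i _.
rewrite st /joint; congr (Pr P _); apply/seteqP.
by case: (nth _ _ _) => a b; split => w /= [-> ->].
Qed.

Lemma joint_split E n : measurable E ->
  Pr P E = \sum_(x : n.-tuple XT) Pr P (E `&` starts_with X x).
Proof.
move=> mE; apply: Pr_partition => [x|w Ew|x w []//]; first exact: measurableI.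
exists [tuple X i w | i < n].
  split => //; rewrite /starts_with /= size_map size_enum_ord /mkseq -val_enum_ord.
  by rewrite -map_comp.
move=> x [_]; rewrite /starts_with /= size_tuple => xE; apply/val_inj => /=.
by rewrite -xE /mkseq -val_enum_ord -map_comp.
Qed.

Lemma Pr_Y (y : seq YT) :
  Pr P (starts_with Y y) =
  \sum_(x : (size y).-tuple XT) \prod_(l <- zip x y) joint l.1 l.2.
Proof.
rewrite (joint_split (size y)) //; apply: eq_bigr => x _.
by rewrite setIC Pr_joint // size_tuple.
Qed.

Lemma S_listE (x : seq XT) : (1 <= size x <= kappa)%N ->
  S_list P kappa X S (map (@letter XT) x) =
  cPr P [set w | (S w <= size x)%N] (starts_with X x).
Proof.
by rewrite /S_list size_map => ->; rewrite starts_with_map //; exact: letter_inj.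
Qed.

Hypothesis S_gt0 : forall w, (1 <= S w)%N.
Hypothesis indep : independent_randomization P X Y S.

(** Independence is assumed for the events S = j one at a time, so S <= n is first split over j. *)
Lemma Pr_S_joint (x : seq XT) (y : seq YT) : size x = size y -> (size x <= kappa)%N ->
  Pr P ([set w | (S w <= size x)%N] `&` starts_with Y y `&` starts_with X x) =
  S_list P kappa X S (map (@letter XT) x) * \prod_(l <- zip x y) joint l.1 l.2.
Proof.
move=> xy xk; rewrite -Pr_joint //.
(* At the empty string [S_list] returns 0 by convention, which is the right value because S is
   positive. *)
have [x0|x0] := posnP (size x).
  rewrite x0 /S_list size_map x0 mul0r (_ : [set w | _] = set0) ?set0I ?Pr_set0 //.
  by apply/seteqP; split => // w /=; rewrite leqn0 => /eqP w0; have := S_gt0 w; rewrite w0.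
rewrite S_listE ?x0 //; set n := size x.
have le_split D : measurable D -> Pr P ([set w | (S w <= n)%N] `&` D) =
    \sum_(j < n.+1) Pr P (S @^-1` [set (j : nat)] `&` D).
  move=> mD; apply: Pr_partition => [j|w [Sn Dw]|j w [/= -> ?]].
  - by apply: measurableI => //; exact: measurable_S.
  - by exists (inord (S w)); rewrite /= ?inordK // => j [/= -> _]; rewrite inord_val.
  - by split => //=; rewrite -ltnS.
rewrite -setIA le_split; last exact: measurableI.
(* Independence given a null event carries no information, but both sides are 0 there. *)
have [q0|q0] := eqVneq (Pr P (starts_with X x)) 0.
  rewrite /cPr q0 invr0 mulr0 mul0r big1 // => j _.
  by rewrite setIA Pr_setI0 //; apply: measurableI => //; exact: measurable_S.
rewrite /cPr le_split // mulrAC mulr_suml mulr_suml; apply: eq_bigr => j _.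
have := indep j (Tuple (eqxx (size x))) (Tuple (introT eqP (esym xy))).
rewrite /cPr /= => /(congr1 (fun r => r * Pr P (starts_with X x))).
rewrite mulfVK // -setIA => ->; rewrite -!mulrA; congr (_ * _).
by rewrite mulVf // mulr1 mulrC setIC.
Qed.

Lemma Pr_S_le (y : seq YT) : (size y <= kappa)%N ->
  Pr P ([set w | (S w <= size y)%N] `&` starts_with Y y) =
  \sum_(x : (size y).-tuple XT) S_list P kappa X S (map (@letter XT) x) *
    \prod_(l <- zip x y) joint l.1 l.2.
Proof.
move=> yk; rewrite (joint_split (size y)); last exact: measurableI.
by apply: eq_bigr => x _; rewrite -Pr_S_joint ?size_tuple.
Qed.

Lemma a_E y : a_ P Y S y = Pr P ([set w | (size y < S w)%N] `&` starts_with Y y).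
Proof. by rewrite /a_ Pr_cPr. Qed.

Lemma a_S_le y : a_ P Y S y =
  Pr P (starts_with Y y) - Pr P ([set w | (S w <= size y)%N] `&` starts_with Y y).
Proof.
apply/eqP; rewrite eq_sym subr_eq a_E; apply/eqP.
rewrite (@Pr_partition _ _ _ P bool (fun b => (if b then [set w | (size y < S w)%N]
  else [set w | (S w <= size y)%N]) `&` starts_with Y y)) ?big_bool //.
- by case; exact: measurableI.
- move=> w Yw; exists (size y < S w)%N => [|b [+ _]].
    by case: ltnP.
  by case: b => /=; [move=> ->|rewrite ltnNge => ->].
- by move=> b w [].
Qed.

Lemma a_sum y : (size y <= kappa)%N -> a_ P Y S y =
  \sum_(x : (size y).-tuple XT) (1 - S_list P kappa X S (map (@letter XT) x)) *
    \prod_(l <- zip x y) joint l.1 l.2.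
Proof.
move=> yk; rewrite a_S_le Pr_Y Pr_S_le // -sumrB; apply: eq_bigr => x _.
by rewrite mulrBl mul1r.
Qed.

Lemma S_list_perm (x x' : seq XT) : permutation_invariant P kappa X S ->
  perm_eq x x' ->
  S_list P kappa X S (map (@letter XT) x) = S_list P kappa X S (map (@letter XT) x').
Proof.
move=> hp xx'; have sx := perm_size xx'.
case: (boolP (1 <= size x <= kappa)%N) => hx; last first.
  by rewrite /S_list !size_map -sx (negbTE hx).
rewrite !S_listE -?sx //.
have := hp (size x) (in_tuple x).
have /tuple_permP[p pE] : perm_eq (Tuple (introT eqP (esym sx))) (in_tuple x).
  by rewrite perm_sym.
by move=> /(_ p hx) ->; rewrite -pE.
Qed.

(** With [n] the value of S, this turns the positive part of m - S into a sum of indicators of the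
    events S <= k. *)
Lemma diff_count m n : (m - n)%:R = \sum_(k < m) (n <= k)%N%:R :> R.
Proof.
elim: m => [|m IH]; first by rewrite sub0n big_ord0.
rewrite big_ord_recr /= -IH; case: leqP => h; first by rewrite subSn // -natr1.
by rewrite addr0 (_ : m.+1 - n = m - n)%N //; lia.
Qed.

Lemma b_E y : b_ P Y S y =
  \sum_(k < size y) Pr P ([set w | (S w <= k)%N] `&` starts_with Y y).
Proof.
rewrite /b_ /cE mulrCA /Rintegral.
rewrite (@integral_indic_sum _ _ _ P _ (fun k : 'I_(size y) => [set w | (S w <= k)%N])) //.
  have [q0|q0] := eqVneq (Pr P (starts_with Y y)) 0; last by rewrite divff // mulr1.
  by rewrite q0 mul0r mulr0 big1 // => k _; rewrite Pr_setI0.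
move=> w _; rewrite diff_count; apply: eq_bigr => k _.
rewrite indicE; congr (_%:R); apply/esym.
by case: (boolP (S w <= k)%N) => h; [rewrite mem_set|rewrite memNset //= (negbTE h)].
Qed.

Lemma Pr_next E y : measurable E ->
  \sum_c Pr P (E `&` starts_with Y (rcons y c)) = Pr P (E `&` starts_with Y y).
Proof.
move=> mE; apply/esym/Pr_partition => [c|w [Ew Yw]|c w [Ew]].
- exact: measurableI.
- exists (Y (size y) w) => [|c [_]]; first by rewrite starts_with_rcons.
  by rewrite starts_with_rcons => -[_ /= ->].
- by rewrite starts_with_rcons => -[].
Qed.

(** In [b_E], appending a letter adds the term k = [size y], and summing over the letter removes the
    condition on it from every term. *)
Lemma b_next y : \sum_c b_ P Y S (rcons y c) =
  b_ P Y S y + Pr P ([set w | (S w <= size y)%N] `&` starts_with Y y).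
Proof.
under eq_bigr do rewrite b_E size_rcons.
rewrite exchange_big /=; under eq_bigr do rewrite Pr_next //.
by rewrite big_ord_recr b_E.
Qed.

Lemma b_nil : b_ P Y S [::] = 0.
Proof. by rewrite b_E big_ord0. Qed.

(** * Stopping time of a cut tree *)

Section TreeTime.
Variables (stop : pred (seq YT)) (c0 : YT).
Hypothesis stopk : forall y, size y = kappa -> stop y.
Let T : {set kappa.-bseq YT} := cut_tree kappa stop.

(** The leaf met by a path is its shortest stopped prefix, which exists by [stopk]. Uniqueness
    identifies it with the leaf found by [tree_time] and lets the leaves index a partition. *)
Lemma tree_timeP w : exists z : kappa.-bseq YT,
  [/\ z \in leaves T, starts_with Y z w, size z = tree_time Y T w &
      forall z' : kappa.-bseq YT, z' \in leaves T -> starts_with Y z' w -> z' = z].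
Proof.
have take_mk k n : (k <= n)%N -> take k (mkseq (Y^~ w) n) = mkseq (Y^~ w) k.
  by move=> kn; rewrite /mkseq -map_take take_iota (minn_idPl kn).
have ex : exists n, stop (mkseq (Y^~ w) n).
  by exists kappa; rewrite stopk // size_mkseq.
pose n := ex_minn ex.
have [sn min_n] : stop (mkseq (Y^~ w) n) /\ forall m, stop (mkseq (Y^~ w) m) -> (n <= m)%N.
  by rewrite /n; case: ex_minnP.
have nk : (size (mkseq (Y^~ w) n) <= kappa)%N.
  by rewrite size_mkseq; apply: min_n; rewrite stopk // size_mkseq.
pose z := Bseq nk.
have zl : z \in leaves T.
  rewrite (leaves_cut c0 stopk) /= sn andbT inE; apply/reachedP => k /=.
  rewrite size_mkseq => kn; rewrite take_mk ?(ltnW kn) //.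
  by apply: contraL kn => /min_n; rewrite -leqNgt.
have uz (z' : kappa.-bseq YT) : z' \in leaves T -> starts_with Y z' w -> z' = z.
  rewrite (leaves_cut c0 stopk) inE => /andP[/reachedP zr sz']; rewrite /starts_with /= => ez.
  apply/val_inj => /=; rewrite -ez; congr mkseq; apply/eqP.
  rewrite eqn_leq min_n ?ez // andbT leqNgt; apply/negP => nz.
  by have := zr _ nz; rewrite -[X in take _ X]ez take_mk ?sn // ltnW.
exists z; split => //; first by rewrite /starts_with /= size_mkseq.
rewrite size_mkseq /tree_time; set q := (fun n => _).
have qn : q n by apply/exists_inP; exists z.
have hq : has q (iota 0 kappa.+1).
  by apply/hasP; exists n => //; rewrite mem_iota /= add0n ltnS -(size_mkseq (Y^~ w) n).
have fk : (find q (iota 0 kappa.+1) < kappa.+1)%N by move: hq; rewrite has_find size_iota.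
have := nth_find 0%N hq; rewrite nth_iota //.
rewrite add0n => /exists_inP[z' z'l /eqP z'E].
have sz' : size z' = find q (iota 0 kappa.+1) by rewrite z'E size_mkseq.
rewrite -sz' (uz z') ?size_mkseq //.
by rewrite /starts_with /= sz' -z'E.
Qed.

Lemma Pr_tree_time :
  Pr P [set w | (tree_time Y T w < S w)%N] = \sum_(z in leaves T) a_ P Y S z.
Proof.
rewrite (@Pr_partition _ _ _ P (kappa.-bseq YT) (fun z => if z \in leaves T then
  [set w | (size z < S w)%N] `&` starts_with Y z else set0)).
- rewrite [RHS]big_mkcond; apply: eq_bigr => z _.
  by case: ifP => _; rewrite ?a_E // Pr_set0.
- by move=> z; case: ifP => // _; exact: measurableI.
- move=> w /= lt; have [z [zl Yz sz uz]] := tree_timeP w.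
  exists z => [|z']; first by rewrite zl /= sz.
  by case: ifP => // zl' [_]; exact: uz.
- move=> z w; case: ifP => // zl [/= lt Yz]; have [z' [_ _ <- uz]] := tree_timeP w.
  by rewrite -(uz _ zl Yz).
Qed.

(** The positive part is the sum, over the pairs of a leaf z and a k < |z|, of the indicators that
    the path starts with z and S <= k. *)
Lemma expectation_tree_time :
  fine 'E_P[fun w => (tree_time Y T w - S w)%N%:R] = \sum_(z in leaves T) b_ P Y S z.
Proof.
rewrite unlock.
pose E (i : kappa.-bseq YT * 'I_kappa) := if (i.1 \in leaves T) && (i.2 < size i.1)%N
  then [set w | (S w <= i.2)%N] `&` starts_with Y i.1 else set0.
rewrite (@integral_indic_sum _ _ _ P _ E) //=.
- rewrite -(pair_big xpredT xpredT (fun i j => Pr P (E (i, j) `&` setT))) /=.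
  rewrite [RHS]big_mkcond; apply: eq_bigr => z _; rewrite /E /=.
  case: ifP => _ /=; last by rewrite big1 // => k _; rewrite set0I Pr_set0.
  rewrite b_E (big_ord_widen _ (fun k =>
    Pr P ([set w | (S w <= k)%N] `&` starts_with Y z)) (size_bseq z)) [RHS]big_mkcond.
  by apply: eq_bigr => k _; rewrite setIT; case: ifP; rewrite ?Pr_set0.
- by move=> i; rewrite /E; case: ifP => // _; exact: measurableI.
- move=> w _; have [z [zl Yz <- uz]] := tree_timeP w.
  rewrite -(pair_big xpredT xpredT (fun i j => \1_(E (i, j)) w)) /= (bigD1 z) //=.
  rewrite [X in _ + X]big1 ?addr0; last first.
    move=> z' z'z; rewrite big1 // => k _; rewrite indicE memNset // /E.
    case: ifP => [/andP[/= zl' _]|_ []]; case=> _ /(uz _ zl') z'E.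
    by rewrite z'E eqxx in z'z.
  rewrite diff_count (big_ord_widen _ (fun k => (S w <= k)%N%:R) (size_bseq z)) [LHS]big_mkcond.
  apply: eq_bigr => k _; rewrite /E zl /= indicE; case: ifP => _; last by rewrite memNset.
  case: (boolP (S w <= k)%N) => h; first by rewrite mem_set.
  by rewrite memNset //= => -[]; rewrite (negbTE h).
Qed.

End TreeTime.
End Process.

(** * Generating polynomials of compositions *)

(* The coefficient of 'X^u is the sum, over the strings x with num K x = u, of
   the products of the p (x_i) (s_i). *)
Definition row_poly (R : realType) (nx K : nat) (p : nat -> nat -> R) (s : seq nat) :
  {poly R} := \prod_(g <- s) \sum_(a < nx) p a g *: 'X^(K ^ a).

Lemma row_poly_perm (R : realType) nx K (p : nat -> nat -> R) s t :
  perm_eq s t -> row_poly nx K p s = row_poly nx K p t.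
Proof. by move=> st; rewrite /row_poly (perm_big _ st). Qed.

Lemma sum_tuple_cons (V : nmodType) (A : finType) n (F : seq A -> V) :
  \sum_(x : n.+1.-tuple A) F x = \sum_(a : A) \sum_(x : n.-tuple A) F (a :: x).
Proof.
rewrite pair_big /= (reindex (fun q : A * n.-tuple A => [tuple of q.1 :: q.2])) //=.
exists (fun x => (thead x, [tuple of behead x])) => [[a x] _|x _] /=.
  by rewrite theadE; congr (_, _); apply/val_inj.
by rewrite -tuple_eta.
Qed.

Lemma row_polyE (R : realType) (A B : finType) K (p : nat -> nat -> R) (y : seq B) :
  row_poly #|A| K p (map (@letter B) y) =
  \sum_(x : (size y).-tuple A)
    (\prod_(l <- zip x y) p (letter l.1) (letter l.2)) *:
      'X^(num K (map (@letter A) x)).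
Proof.
rewrite /row_poly big_map; elim: y => [|c y IH] /=.
  rewrite big_nil (big_pred1 [tuple]) => [|x]; last exact/esym/eqP/tuple0.
  by rewrite big_nil scale1r /num big_nil expr0.
rewrite big_cons IH (sum_tuple_cons _ (fun x : seq A => (\prod_(l <- zip x (c :: y))
  p (letter l.1) (letter l.2)) *: 'X^(num K (map (@letter A) x)))).
rewrite mulr_suml (reindex (@enum_rank A)) /=; last first.
  by apply: onW_bij; exact: enum_rank_bij.
apply: eq_bigr => a _; rewrite mulr_sumr; apply: eq_bigr => x _ /=.
rewrite big_cons /= -scalerAl -scalerAr scalerA; congr (_ *: _).
by rewrite -exprD /num big_cons.
Qed.

(** A weight depending on x only through its composition can be applied coefficient by coefficient;
    [N] exceeds all exponents, so that none is lost. *)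
Lemma row_poly_sum (R : realType) (A B : finType) K (p : nat -> nat -> R) (y : seq B)
  (F : nat -> R) N :
  (forall x : (size y).-tuple A, (num K (map (@letter A) x) < N)%N) ->
  \sum_(u < N) F u * (row_poly #|A| K p (map (@letter B) y))`_u =
  \sum_(x : (size y).-tuple A) F (num K (map (@letter A) x)) *
    \prod_(l <- zip x y) p (letter l.1) (letter l.2).
Proof.
move=> ltN; under eq_bigr do rewrite row_polyE coef_sum mulr_sumr.
rewrite exchange_big /=; apply: eq_bigr => x _.
rewrite (bigD1 (Ordinal (ltN x))) //= coefZ coefXn eqxx mulr1 [X in _ + X]big1 ?addr0 // => u.
by rewrite -val_eqE /= => /negbTE h; rewrite coefZ coefXn h !mulr0.
Qed.

(** * The maximum of g over a cut tree *)

Section Selection.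
Variables (R : realType) (d : measure_display) (Om : measurableType d).
Variables (P : probability Om R) (A : finType) (Y : nat -> Om -> A) (S : Om -> nat).
Variables (kappa : nat) (c0 : A) (stop : pred (seq A)).
Hypothesis stopk : forall y, size y = kappa -> stop y.
Let T : {set kappa.-bseq A} := cut_tree kappa stop.

Lemma setT_cut :
  [set: kappa.-bseq A]%SET = cut_tree kappa (fun y : seq A => size y == kappa).
Proof.
apply/finset.setP => y; rewrite !inE; apply/esym/reachedP => n ny.
rewrite size_takel ?(ltnW ny) //; have := size_bseq y; lia.
Qed.

Lemma max_g_root : stop [::] -> max_g P Y S T = 0%E.
Proof.
move=> s0; rewrite /max_g (_ : T == _); first by [].
apply/eqP/finset.setP => y; rewrite finset.in_set1 inE; apply/reachedP/eqP => [h|-> //].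
apply/val_inj/nilP; rewrite /nilp -leqn0 leqNgt; apply/negP => /h.
by rewrite take0 s0.
Qed.

Lemma max_gE (y0 : kappa.-bseq A) : y0 \in internal T ->
  (forall y, y \in internal T -> (g_ P Y S T y <= g_ P Y S T y0)%E) ->
  max_g P Y S T = g_ P Y S T y0.
Proof.
(* An internal node has a child, so the convention for the tree reduced to its root does not
   apply. *)
move=> yi ymax; rewrite /max_g ifN; last first.
  apply/eqP => TE; have [] := ext_cut c0 stopk c0 yi; rewrite -/T TE finset.in_set1.
  by move=> /eqP ->; case: (y0 : seq A).
apply/le_anti/andP; split.
  by apply/bigmax_leP; split => [|y]; [rewrite leNye|exact: ymax].
by rewrite (bigD1 y0) //= le_max lexx.
Qed.

End Selection.

Lemma updE (V : Type) (f : nat -> nat -> V) k i v k' i' :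
  upd f k i v k' i' = if (k' == k) && (i' == i) then v else f k' i'.
Proof. by []. Qed.

Lemma mkseq_upd (f g : nat -> nat) n v :
  (forall i, (i < n)%N -> g i = f i) -> g n = v ->
  mkseq g n.+1 = rcons (mkseq f n) v.
Proof.
move=> gf gn; rewrite /mkseq -[X in iota 0 X]addn1 iotaD map_cat /= add0n gn cats1.
by congr rcons; apply/eq_in_map => i; rewrite mem_iota /= add0n => /gf.
Qed.

Lemma frame_i (R : Type) c (s s' : memory R) k :
  frame c s s' -> untouched_i k c -> imem s' k = imem s k.
Proof. by case=> + _; exact. Qed.

Lemma frame_r (R : Type) c (s s' : memory R) k :
  frame c s s' -> untouched_r k c -> rmem s' k = rmem s k.
Proof. by case=> _; exact. Qed.

(** * The program *)

(* Integer arrays.  1: number of completed rounds; 2: flags of lambda; 3: trees;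
   4: powers of kappa + 1; 5: string being decoded, with its length in 9 and the
   rest of its number in 8; 6: flags of g; 7: compositions of the nodes of the
   current tree; 17: composition maximizing g so far; 18: stopping flag;
   19: offset of the current tree in 3; all others: counters.
   Real arrays.  0: joint law; 1, 2, 3: lambda, alpha, d; 4: list specifying S,
   by composition; 5: coefficients of a row_poly, preceded by (kappa + 1)^|A|
   zeros so that no index is truncated when they are shifted; for a node y of
   given composition and length n, 6: a(y); 7: P(S <= n, Y^n = y); 8: a(T_y);
   9: b(T_y) - b(y); 10: g(y), or 0 if g(y) is infinite. *)

Definition cpowers (n : nat) : cmd :=
  CSeq (CISet 4 (ICst 0) (ICst 1))
    (CSeqs n (fun i => CSeq (CISet 4 (ICst i.+1) (ICst 0))
       (CFor 20 (IAdd (IVar 0) (ICst 1))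
          (CISet 4 (ICst i.+1) (IAdd (IGet 4 (ICst i.+1)) (IGet 4 (ICst i))))))).

(* Greedy expansion in base kappa + 1 turns a composition into a string having
   that composition. *)
Fixpoint cdecode (n : nat) : cmd :=
  if n is m.+1 then
    CSeq (CWhile (BILe (IGet 4 (ICst m)) (IVar 8))
            (CSeq (assign 8 (ISub (IVar 8) (IGet 4 (ICst m))))
               (CSeq (CISet 5 (IVar 9) (ICst m))
                  (assign 9 (IAdd (IVar 9) (ICst 1))))))
      (cdecode m)
  else CSkip.

Lemma cdecode_untouched_i n k :
  k \notin [:: 5; 8; 9]%N -> untouched_i k (cdecode n).
Proof.
rewrite !inE !negb_or => /and3P[h1 h2 h3].
by elim: n => //= n ->; rewrite h1 h2 h3.
Qed.

Lemma cdecode_untouched_r n k : untouched_r k (cdecode n).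
Proof. by elim: n => //= n ->. Qed.

(** All numbers below (kappa + 1)^a are decoded and queried; a decoded string longer than [kappa]
    gets the default entry 0 of [S_list]. *)
Definition cquery (a : nat) : cmd :=
  CFor 11 (IGet 4 (ICst a))
    (CSeq (CSeq (assign 8 (IVar 11)) (assign 9 (ICst 0)))
       (CSeq (cdecode a) (CQuery 4 (IVar 11) 5 (IVar 9)))).

Definition crow_init (a : nat) : cmd :=
  CSeq (CFor 13 (IGet 4 (ICst a))
          (CRSet 5 (IAdd (IGet 4 (ICst a)) (IVar 13)) (RCst 0)))
    (CRSet 5 (IGet 4 (ICst a)) (RCst 1)).

Definition row_cell (a : nat) : iexp :=
  ISub (IAdd (IGet 4 (ICst a)) (IGet 4 (ICst a))) (IAdd (IVar 15) (ICst 1)).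

(** Multiplication in place: from the highest cell down, each cell reads only lower ones, which
    still hold the old coefficients. Degrees from (kappa + 1)^a on are dropped, which does not
    affect the lower ones. *)
Definition crow_step (a b : nat) : cmd :=
  CFor 15 (IGet 4 (ICst a))
    (CRSet 5 (row_cell a)
       (RSum a (fun i => RMul (RGet 5 (ISub (row_cell a) (IGet 4 (ICst i))))
          (RGet 0 (IAdd (ICst (i * b)) (IGet 5 (IVar 14))))))).

Definition crow (a b : nat) : cmd :=
  CSeq (crow_init a) (CFor 14 (IVar 9) (crow_step a b)).

Definition crow_sum (a : nat) : cmd :=
  CSeq (CSeq (CRSet 6 (IVar 12) (RCst 0)) (CRSet 7 (IVar 12) (RCst 0)))
    (CFor 13 (IGet 4 (ICst a))
       (CSeq (CRSet 6 (IVar 12) (RAdd (RGet 6 (IVar 12))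
                (RMul (RSub (RCst 1) (RGet 4 (IVar 13)))
                   (RGet 5 (IAdd (IGet 4 (ICst a)) (IVar 13))))))
          (CRSet 7 (IVar 12) (RAdd (RGet 7 (IVar 12))
                (RMul (RGet 4 (IVar 13))
                   (RGet 5 (IAdd (IGet 4 (ICst a)) (IVar 13)))))))).

(** By truncation, 1 - (kappa - length) is 1 exactly when the length is at least [kappa]: it marks
    the leaves of the complete tree. *)
Definition crows (a b : nat) : cmd :=
  CFor 12 (IGet 4 (ICst b))
    (CSeq (CSeq (CSeq (assign 8 (IVar 12)) (assign 9 (ICst 0))) (cdecode b))
       (CSeq (CISet 3 (IVar 12) (ISub (ICst 1) (ISub (IVar 0) (IVar 9))))
          (CSeq (crow a b) (crow_sum a)))).

Definition powers_ok (R : Type) (K n : nat) (s : memory R) : Prop :=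
  forall i, (i <= n)%N -> imem s 4 i = (K ^ i)%N.

Definition digits (n kappa u : nat) (t : seq nat) : Prop :=
  [/\ all (gtn n) t, forall i, (i < n)%N -> (count_mem i t <= kappa)%N
    & num kappa.+1 t = u].

(** * Correctness of the tables computed before the first round *)

Section Programs.
Variables (R : realType) (tab : seq nat -> R) (acc N kappa : nat).
Local Notation wp := (@wp R tab acc N).
Local Notation K := kappa.+1.

(** In the absence of a product of naturals, each power is the previous one added kappa + 1
    times. *)
Lemma cpowers_spec n (s : memory R) : (K <= N)%N -> imem s 0 0 = kappa ->
  wp (cpowers n) (powers_ok K n) s.
Proof.
move=> KN k0; apply/wp_seq/wp_iset => /=; set s0 := set_i _ _ _ _.
apply: (wp_seqs (I := fun j s' => powers_ok K j s')) => [||s' _ //].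
  by move=> i; rewrite leqn0 => /eqP->.
move=> j s1 jn fr h1; apply: wp_seq; apply: wp_iset => /=.
have k1 : imem s1 0 0 = kappa.
  by rewrite (frame_i fr) ?untouched_i_CSeqs.
apply: (wp_for (n := K) (I := fun i s' => powers_ok K j s' /\
   imem s' 4 j.+1 = (i * K ^ j)%N)) => //.
- by move=> s' f; rewrite /= (frame_i (k := 0) f) //= !updE /= k1 addn1.
- split=> [i ij|]; rewrite /= !updE /= ?eqxx //.
  by rewrite ltn_eqF // h1.
- move=> i s' iK f si [h2 h3]; apply: wp_iset; split => [i' ij|] /=; rewrite !updE /=.
    by rewrite ltn_eqF // h2.
  by rewrite eqxx h3 (h2 j) // mulSn addnC.
- move=> s' _ [h2 h3] i; rewrite leq_eqVlt => /predU1P[->|]; last exact: h2.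
  by rewrite h3 expnS.
Qed.

Lemma cdecode_spec n u l0 (s : memory R) : powers_ok K n s -> (u <= N)%N ->
  imem s 8 0 = u -> imem s 9 0 = l0 -> (u < K ^ n)%N ->
  wp (cdecode n) (fun s' => exists2 t, digits n kappa u t &
    imem s' 9 0 = (l0 + size t)%N /\
    mkseq (imem s' 5) (l0 + size t) = mkseq (imem s 5) l0 ++ t) s.
Proof.
elim: n u l0 s => [|n IH] u l0 s pw uN s8 s9 un /=.
  apply: wp_skip; exists [::]; last by rewrite addn0 cats0.
  by split => //; rewrite /num big_nil; move: un; rewrite ltnS leqn0 => /eqP.
apply: wp_seq; apply: (wp_while (I := fun j s' => [/\ imem s' 8 0 + j * K ^ n = u,
   imem s' 9 0 = l0 + j & mkseq (imem s' 5) (l0 + j) = mkseq (imem s 5) l0 ++ nseq j n]%N)).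
- by rewrite s8 s9 addn0 cats0 mul0n addn0.
- move=> j s1 f /=; rewrite (frame_i (k := 4) f) // pw // => h [h1 h2 h3]; split.
    (* Each pass takes at least 1 away from [u <= N], which bounds the number of passes. *)
    have K0 : (0 < K ^ n)%N by rewrite expn_gt0.
    by apply: leq_trans uN; rewrite -h1 mulnC; nia.
  apply: wp_seq; apply: wp_iset; apply: wp_seq; apply: wp_iset; apply: wp_iset => /=.
  rewrite !updE /= (frame_i (k := 4) f) // pw //; split.
  + by rewrite mulSn addnA subnK.
  + by rewrite h2; lia.
  + rewrite (addnS l0) (@mkseq_upd (imem s1 5) _ _ n).
    * by rewrite h3 rcons_cat -cats1 -[[:: n]]/(nseq 1 n) -nseqD addnC.
    * by move=> i il; rewrite !updE h2 /= ltn_eqF.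
    * by rewrite !updE /= h2 eqxx.
- move=> j s1 f /=; rewrite (frame_i (k := 4) f) // pw // -ltnNge => h [h1 h2 h3].
  have jk : (j <= kappa)%N.
    rewrite -ltnS -(@ltn_pmul2r (K ^ n)) ?expn_gt0 // -expnS.
    by apply: leq_ltn_trans un; rewrite -h1 leq_addl.
  have u1N : (imem s1 8 0 <= N)%N by apply: leq_trans uN; rewrite -h1 leq_addr.
  apply: wp_mono (IH _ (l0 + j)%N s1 _ u1N erefl h2 h) => [s' _ [t [t1 t2 t3] [t4 t5]]|]; last first.
    by move=> i ni; rewrite (frame_i (k := 4) f) // pw // ltnW.
  exists (nseq j n ++ t).
    split.
    + rewrite all_cat all_nseq /= ltnSn orbT /=; apply: sub_all t1 => x /=.
      by move=> /ltnW.
    + move=> i; rewrite ltnS leq_eqVlt count_cat count_nseq => /predU1P[->|ilt] /=.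
        rewrite eqxx mul1n (count_memPn _) ?addn0 //.
        by apply/negP => /(allP t1) /=; rewrite ltnn.
      by rewrite gtn_eqF // mul0n t2.
    + rewrite num_cat t3 -h1 addnC; congr addn.
      by rewrite /num big_nseq iter_addn_0 mulnC.
  by rewrite size_cat size_nseq addnA; split; rewrite // t5 h3 catA.
Qed.

Lemma cquery_spec a (s : memory R) : powers_ok K a s -> (K ^ a <= N)%N ->
  wp (cquery a) (fun s' => forall u, (u < K ^ a)%N ->
    exists2 t, digits a kappa u t & rmem s' 4 u = tab t) s.
Proof.
move=> pw aN; apply: (wp_for (n := (K ^ a)%N) (I := fun j s' =>
  forall u, (u < j)%N -> exists2 t, digits a kappa u t & rmem s' 4 u = tab t)) => //.
- by rewrite /= cdecode_untouched_i.
- by move=> s' f; rewrite /= (frame_i (k := 4) f) /= ?cdecode_untouched_i // pw.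
- move=> u s1 ua f s11 H; apply: wp_seq; apply: wp_seq; apply: wp_iset; apply: wp_iset => /=.
  apply: wp_seq; set s2 := set_i _ _ _ _.
  have pw2 : powers_ok K a s2.
    by move=> i ia; rewrite /s2 /= !updE /= (frame_i (k := 4) f) /= ?cdecode_untouched_i // pw.
  have s28 : imem s2 8 0 = u by rewrite /s2 /= !updE.
  have s29 : imem s2 9 0 = 0%N by [].
  apply: wp_mono (cdecode_spec pw2 (leq_trans (ltnW ua) aN) s28 s29 ua) => s3 f3.
  move=> -[t ht]; rewrite add0n => -[h9 h5]; apply: wp_query => v.
  rewrite /= updE (frame_i (k := 11) f3) ?cdecode_untouched_i // /s2 /= !updE /= s11.
  rewrite ltnS leq_eqVlt => /predU1P[->|vu]; first by rewrite eqxx h9 h5; exists t.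
  rewrite ltn_eqF // (frame_r f3) ?cdecode_untouched_r //.
  exact: H.
Qed.

Lemma crow_init_spec a (s : memory R) : powers_ok K a s -> (K ^ a <= N)%N ->
  (forall v, (v < K ^ a)%N -> rmem s 5 v = 0) ->
  wp (crow_init a) (fun s' => forall v, (v < K ^ a + K ^ a)%N ->
    rmem s' 5 v = ('X^(K ^ a) : {poly R})`_v) s.
Proof.
move=> pw aN pad; have K0 : (0 < K ^ a)%N by rewrite expn_gt0.
apply: wp_seq; apply: (wp_for (n := (K ^ a)%N) (I := fun j s' =>
  forall v, (v < K ^ a + j)%N -> rmem s' 5 v = 0)) => //.
- by move=> s' f; rewrite /= (frame_i (k := 4) f) // pw.
- by move=> v; rewrite addn0; exact: pad.
- move=> j s1 ja f s1j H; apply: wp_rset => v /=.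
  rewrite (frame_i (k := 4) f) // pw // s1j addnS ltnS leq_eqVlt updE /=.
  by case: eqP => //= _; exact: H.
- move=> s1 f H; apply: wp_rset => v vlt /=; rewrite (frame_i (k := 4) f) // pw //.
  by rewrite updE /= coefXn; case: eqP => // _; exact: H.
Qed.

(** If [e i] exceeded [v], the truncated index would read the constant coefficient where there
    should be no contribution. The shift by ['X^(K ^ a)] makes the hypothesis hold. *)
Lemma coefM_sumX (Z : {poly R}) a (p : nat -> R) (e : nat -> nat) v :
  (forall i, (i < a)%N -> (e i <= v)%N) ->
  (Z * \sum_(i < a) p i *: 'X^(e i))`_v = \sum_(i < a) Z`_(v - e i) * p i.
Proof.
move=> ev; rewrite mulr_sumr coef_sum; apply: eq_bigr => i _.
by rewrite -scalerAr coefZ coefMXn ltnNge ev //= mulrC.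
Qed.

Lemma crow_step_spec a b (s : memory R) (Q : {poly R}) :
  powers_ok K a s -> (K ^ a <= N)%N ->
  (forall v, (v < K ^ a + K ^ a)%N -> rmem s 5 v = (Q * 'X^(K ^ a))`_v) ->
  wp (crow_step a b) (fun s' => forall v, (v < K ^ a + K ^ a)%N ->
    rmem s' 5 v = (Q * (\sum_(i < a) rmem s 0 (i * b + imem s 5 (imem s 14 0))%N *:
      'X^(K ^ i)) * 'X^(K ^ a))`_v) s.
Proof.
move=> pw aN HQ; set Q' := Q * _; set M := (K ^ a + K ^ a)%N.
apply: (wp_for (n := (K ^ a)%N) (I := fun j s' => forall v, (v < M)%N ->
  rmem s' 5 v = if (v < M - j)%N then (Q * 'X^(K ^ a))`_v else (Q' * 'X^(K ^ a))`_v)) => //.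
- by move=> s' f; rewrite /= (frame_i (k := 4) f) // pw.
- by move=> v; rewrite subn0 => vM; rewrite vM /= HQ.
- move=> j s1 ja f s1j H; apply: wp_rset => v vM /=.
  rewrite (frame_i (k := 4) f) // pw // s1j addn1 -/M updE /=.
  have [->|vj] := eqVneq v (M - j.+1)%N; last first.
    by rewrite H // !ltnNge; congr (if ~~ _ then _ else _); rewrite /M in vj *; lia.
  rewrite ltnn reval_RSum /Q' mulrAC
    (@coefM_sumX _ a (fun i => rmem s 0 (i * b + imem s 5 (imem s 14 0))%N)
      (fun i => K ^ i)%N) => [|i ia]; last first.
    rewrite (_ : M - j.+1 = K ^ a + (K ^ a - j.+1))%N; last by rewrite /M; lia.
    by rewrite (leq_trans _ (leq_addr _ _)) // leq_pexp2l // ltnW.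
  apply: eq_bigr => i _ /=; rewrite !(frame_i (k := 4) f) // !pw // ?(ltnW (ltn_ord i)) //.
  have e0 : (0 < K ^ i)%N by rewrite expn_gt0.
  have M0 : (M - j.+1 < M - j)%N by rewrite /M; lia.
  rewrite s1j addn1 -/M H; last by rewrite /M in M0 *; lia.
  rewrite (leq_ltn_trans (leq_subr _ _) M0) (frame_r (k := 0) f) //.
  by rewrite (frame_i (k := 5) f) // (frame_i (k := 14) f).
(* The cells below [K ^ a] are not rewritten, but both polynomials are multiples of ['X^(K ^ a)] and
   vanish there. *)
- move=> s1 f H v vM; rewrite H // /M addnK; case: ifP => // va.
  by rewrite !coefMXn va.
Qed.

Definition cell (b : nat) (s : memory R) (x y : nat) : R := rmem s 0 (x * b + y)%N.

Lemma crow_spec a b (s : memory R) (t : seq nat) :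
  powers_ok K a s -> (K ^ a <= N)%N -> (size t <= N)%N ->
  imem s 9 0 = size t -> mkseq (imem s 5) (size t) = t ->
  (forall v, (v < K ^ a)%N -> rmem s 5 v = 0) ->
  wp (crow a b) (fun s' => forall v, (v < K ^ a + K ^ a)%N ->
    rmem s' 5 v = (row_poly a K (cell b s) t * 'X^(K ^ a))`_v) s.
Proof.
move=> pw aN tN s9 s5 pad; apply: wp_seq.
apply: wp_mono (crow_init_spec pw aN pad) => s1 f1 H1.
apply: (wp_for (n := size t) (I := fun i s' => forall v, (v < K ^ a + K ^ a)%N ->
  rmem s' 5 v = (row_poly a K (cell b s) (take i t) * 'X^(K ^ a))`_v)) => //.
- by move=> s' f; rewrite /= (frame_i (k := 9) f) // (frame_i (k := 9) f1).
- by rewrite take0 /row_poly big_nil mul1r.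
- move=> i s2 it f2 s2i H2.
  have pw2 : powers_ok K a s2.
    by move=> j ja; rewrite (frame_i (k := 4) f2) // (frame_i (k := 4) f1) // pw.
  apply: wp_mono (crow_step_spec b pw2 aN H2) => s3 _ H3 v vM; rewrite /= H3 //.
  have ti : nth 0%N t i = imem s 5 i by rewrite -{1}s5 nth_mkseq.
  rewrite (take_nth 0%N it) -[in RHS]cats1 /row_poly big_cat big_seq1 /=.
  rewrite s2i (frame_i (k := 5) f2) // (frame_i (k := 5) f1) // ti.
  by rewrite (frame_r (k := 0) f2) // (frame_r (k := 0) f1).
- by move=> s2 _; rewrite take_size.
Qed.

Lemma crow_sum_spec a c (s : memory R) (Q : {poly R}) :
  powers_ok K a s -> (K ^ a <= N)%N -> imem s 12 0 = c ->
  (forall v, (v < K ^ a + K ^ a)%N -> rmem s 5 v = (Q * 'X^(K ^ a))`_v) ->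
  wp (crow_sum a) (fun s' =>
    [/\ rmem s' 6 c = \sum_(u < K ^ a) (1 - rmem s 4 u) * Q`_u,
        rmem s' 7 c = \sum_(u < K ^ a) rmem s 4 u * Q`_u
      & forall c', c' != c -> rmem s' 6 c' = rmem s 6 c' /\ rmem s' 7 c' = rmem s 7 c']) s.
Proof.
move=> pw aN sc HQ; apply/wp_seq/wp_seq/wp_rset/wp_rset => /=; rewrite !sc.
set s0 := set_r _ _ _ _.
apply: (wp_for (n := (K ^ a)%N) (I := fun j s' =>
    [/\ rmem s' 6 c = \sum_(u < j) (1 - rmem s 4 u) * Q`_u,
        rmem s' 7 c = \sum_(u < j) rmem s 4 u * Q`_u
      & forall c', c' != c -> rmem s' 6 c' = rmem s 6 c' /\ rmem s' 7 c' = rmem s 7 c'])) => //.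
- by move=> s' f; rewrite /= (frame_i (k := 4) f) //= pw.
- rewrite /= !updE /= eqxx !big_ord0; split=> // c' /negbTE cc'.
  by rewrite !updE /= cc'.
- move=> j s1 ja f s1j [H6 H7 H]; have s1c : imem s1 12 0 = c by rewrite (frame_i (k := 12) f).
  apply/wp_seq/wp_rset/wp_rset => /=.
  rewrite !updE /= s1c s1j !eqxx /= !big_ord_recr /= -H6 -H7.
  rewrite (frame_r (k := 4) f) // (frame_r (k := 5) f) // (frame_i (k := 4) f) //= pw //.
  rewrite !updE /= HQ ?ltn_add2l // coefMXn ltnNge leq_addr /= addKn; split=> // c' cc'.
  by have [h6 h7] := H _ cc'; rewrite !updE /= (negbTE cc').
Qed.

Lemma crows_spec a b (s : memory R) : powers_ok K a s -> powers_ok K b s ->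
  (K ^ a <= N)%N -> (K ^ b <= N)%N -> imem s 0 0 = kappa ->
  (forall v, (v < K ^ a)%N -> rmem s 5 v = 0) ->
  wp (crows a b) (fun s' => forall c, (c < K ^ b)%N -> exists t,
    [/\ digits b kappa c t, imem s' 3 c = (1 - (kappa - size t))%N,
        rmem s' 6 c = \sum_(u < K ^ a) (1 - rmem s 4 u) * (row_poly a K (cell b s) t)`_u
      & rmem s' 7 c = \sum_(u < K ^ a) rmem s 4 u * (row_poly a K (cell b s) t)`_u]) s.
Proof.
move=> pwa pwb aN bN s0 pad.
have fi k s' : frame (crows a b) s s' -> k \notin [:: 3; 5; 8; 9; 12; 13; 14; 15]%N ->
    imem s' k = imem s k.
  move=> f; rewrite !inE !negb_or => h; apply: (frame_i f); move: h; do ![case/andP => ?] => ?.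
  by rewrite /= cdecode_untouched_i ?inE ?negb_or; do ?[apply/andP; split].
have fr k s' : frame (crows a b) s s' -> k \notin [:: 5; 6; 7]%N ->
    rmem s' k = rmem s k.
  move=> f; rewrite !inE !negb_or => h; apply: (frame_r f); move: h; do ![case/andP => ?] => ?.
  by rewrite /= cdecode_untouched_r; do ?[apply/andP; split].
(* Each row relies on the zeros below [K ^ a], so the invariant has to hand them on. *)
apply: (wp_for (n := (K ^ b)%N) (I := fun j s' =>
    (forall v, (v < K ^ a)%N -> rmem s' 5 v = 0) /\ forall c, (c < j)%N -> exists t,
    [/\ digits b kappa c t, imem s' 3 c = (1 - (kappa - size t))%N,
        rmem s' 6 c = \sum_(u < K ^ a) (1 - rmem s 4 u) * (row_poly a K (cell b s) t)`_u
      & rmem s' 7 c = \sum_(u < K ^ a) rmem s 4 u * (row_poly a K (cell b s) t)`_u])) => //.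
  - by rewrite /= cdecode_untouched_i.
  - by move=> s' f; rewrite /= fi // pwb.
  - move=> c s1 cb f s1c [H5 H]; apply/wp_seq/wp_seq/wp_seq/wp_iset/wp_iset => /=.
    set s2 := set_i _ _ _ _.
    have pw2 : powers_ok K b s2 by move=> i ib; rewrite /s2 /= !updE /= fi // pwb.
    have s28 : imem s2 8 0 = c by rewrite /s2 /= !updE.
    have s29 : imem s2 9 0 = 0%N by [].
    apply: wp_mono (cdecode_spec pw2 (leq_trans (ltnW cb) bN) s28 s29 cb) => s3 f3.
    move=> -[t ht]; rewrite add0n => -[h9 h5].
    have f3i k : k \notin [:: 5; 8; 9]%N -> imem s3 k = imem s1 k.
      by move=> h; rewrite (frame_i f3) ?cdecode_untouched_i // /s2 /= !upd_neq //;
         move: h; rewrite !inE !negb_or => /and3P[].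
    have f3r k : rmem s3 k = rmem s1 k by rewrite (frame_r f3) ?cdecode_untouched_r.
    apply/wp_seq/wp_iset => /=; rewrite f3i // s1c f3i // fi // s0 h9.
    apply: wp_seq; set s4 := set_i _ _ _ _.
    have pw4 : powers_ok K a s4 by move=> i ia; rewrite /s4 /= !updE /= f3i // fi // pwa.
    (* Every letter contributes at least 1 to the number [c], so the loop over [t] also fits in
       [N]. *)
    have tN : (size t <= N)%N.
      apply: leq_trans (leq_trans (ltnW cb) bN); case: ht => _ _ <-.
      exact: size_le_num.
    have c4 x y : cell b s4 x y = cell b s x y by rewrite /cell /s4 /= f3r fr.
    apply: wp_mono (crow_spec b pw4 aN tN h9 h5 _) => [s5 f5|v]; last first.
      by rewrite /s4 /= f3r; exact: H5.
    rewrite (_ : cell b s4 = cell b s); last by apply/funext => x; apply/funext => y.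
    move=> H5'.
    have pw5 : powers_ok K a s5 by move=> i ia; rewrite (frame_i (k := 4) f5) // pw4.
    have s5c : imem s5 12 0 = c by rewrite (frame_i (k := 12) f5) // /s4 /= !updE /= f3i.
    apply: wp_mono (crow_sum_spec pw5 aN s5c H5') => s6 f6 [h6 h7 h67].
    split=> [v va|c'].
      by rewrite (frame_r (k := 5) f6) // H5' ?ltn_addr // coefMXn va.
    rewrite /= !updE /= (frame_i (k := 3) f6) // (frame_i (k := 3) f5) // /s4 /= updE /=.
    rewrite ltnS leq_eqVlt => /predU1P[->|c'c].
      exists t; rewrite eqxx h6 h7 (frame_r (k := 4) f5) // /s4 /= f3r fr //.
    rewrite ltn_eqF // f3i //; have [] := h67 c'; first by rewrite ltn_eqF.
    rewrite (frame_r (k := 6) f5) // (frame_r (k := 7) f5) // /s4 /= !f3r => -> ->.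
    exact: H.
  - by move=> s' _ [].
Qed.

End Programs.

(** * One round of the algorithm *)

Definition cnum : rexp := RGet 9 (IVar 16).
Definition cden : rexp := RSub (RGet 6 (IVar 16)) (RGet 8 (IVar 16)).

Definition csums (b : nat) : cmd :=
  CIf (BILe (ICst 1) (IGet 3 (IAdd (IVar 19) (IVar 16))))
    (CSeq (CRSet 8 (IVar 16) (RGet 6 (IVar 16))) (CRSet 9 (IVar 16) (RCst 0)))
    (CSeq (CRSet 8 (IVar 16)
             (RSum b (fun i => RGet 8 (IAdd (IVar 16) (IGet 4 (ICst i))))))
       (CRSet 9 (IVar 16) (RAdd (RGet 7 (IVar 16))
             (RSum b (fun i => RGet 9 (IAdd (IVar 16) (IGet 4 (ICst i)))))))).

(** Division by 0 yields 0, the value wanted for 0 / 0; the flag singles out a nonzero numerator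
    over 0. Equality to 0 is tested by two inequalities, the only comparison of reals available. *)
Definition cratio : cmd :=
  CSeq (CRSet 10 (IVar 16) (RDiv cnum cden))
    (CSeq (CISet 6 (IVar 16) (ICst 0))
       (CIf (BAnd (BAnd (BRLe cden (RCst 0)) (BRLe (RCst 0) cden))
               (BNot (BAnd (BRLe cnum (RCst 0)) (BRLe (RCst 0) cnum))))
          (CISet 6 (IVar 16) (ICst 1)) CSkip)).

(** A child has a larger number than its parent, so counting down treats it first. Array 7 is
    cleared on the way for the forward pass. *)
Definition cbackward (b : nat) : cmd :=
  CFor 15 (IGet 4 (ICst b))
    (CSeq (CSeq (assign 16 (ISub (IGet 4 (ICst b)) (IAdd (IVar 15) (ICst 1))))
             (CISet 7 (IVar 16) (ICst 0)))
       (CSeq (csums b) cratio)).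

Definition active : bexp :=
  BAnd (BILe (ICst 1) (IGet 7 (IVar 12)))
    (BILe (IGet 3 (IAdd (IVar 19) (IVar 12))) (ICst 0)).

Definition improves : bexp :=
  BAnd (BILe (IGet 6 (IVar 17)) (ICst 0))
    (BNot (BAnd (BILe (IGet 6 (IVar 12)) (ICst 0))
       (BRLe (RGet 10 (IVar 12)) (RGet 10 (IVar 17))))).

Definition attains : bexp :=
  BAnd (BAnd (BILe (IGet 6 (IVar 12)) (IGet 6 (IVar 17)))
          (BILe (IGet 6 (IVar 17)) (IGet 6 (IVar 12))))
    (BAnd (BRLe (RGet 10 (IVar 12)) (RGet 10 (IVar 17)))
       (BRLe (RGet 10 (IVar 17)) (RGet 10 (IVar 12)))).

(** Counting up, a composition is met after those of all its parents, so its membership flag is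
    final by then. The first candidate for the maximum is the root, of composition 0. *)
Definition cforward (b : nat) : cmd :=
  CSeq (CSeq (CISet 7 (ICst 0) (ICst 1)) (assign 17 (ICst 0)))
    (CFor 12 (IGet 4 (ICst b))
       (CIf active
          (CSeq (CSeqs b (fun i => CISet 7 (IAdd (IVar 12) (IGet 4 (ICst i))) (ICst 1)))
             (CIf improves (assign 17 (IVar 12)) CSkip))
          CSkip)).

(** The new table goes into the next block of array 3, since the earlier ones are part of the
    output. *)
Definition cupdate (b : nat) : cmd :=
  CFor 12 (IGet 4 (ICst b))
    (CIf (BAnd active attains)
       (CISet 3 (IAdd (IAdd (IVar 19) (IGet 4 (ICst b))) (IVar 12)) (ICst 1))
       (CISet 3 (IAdd (IAdd (IVar 19) (IGet 4 (ICst b))) (IVar 12))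
          (IGet 3 (IAdd (IVar 19) (IVar 12))))).

Definition nonzero : bexp :=
  BNot (BAnd (BILe (IGet 6 (IVar 17)) (ICst 0))
    (BAnd (BRLe (RGet 10 (IVar 17)) (RCst 0)) (BRLe (RCst 0) (RGet 10 (IVar 17))))).

(** The alpha and d of a tree are its sums at the root, known only after the next backward pass.
    Each round therefore records those of the tree it starts from, and the round that stops still
    records the last ones. *)
Definition cround (b : nat) : cmd :=
  CSeq (cbackward b)
    (CSeq (CSeq (CRSet 2 (IVar 1) (RGet 8 (ICst 0))) (CRSet 3 (IVar 1) (RGet 9 (ICst 0))))
       (CSeq (cforward b)
          (CIf (BAnd (BNot (BILe (ICst 1) (IGet 3 (IVar 19)))) nonzero)
             (CSeq (CSeq (assign 1 (IAdd (IVar 1) (ICst 1)))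
                      (CSeq (CISet 2 (IVar 1) (IGet 6 (IVar 17)))
                         (CRSet 1 (IVar 1) (RGet 10 (IVar 17)))))
                (CSeq (cupdate b) (assign 19 (IAdd (IVar 19) (IGet 4 (ICst b))))))
             (assign 18 (ICst 1))))).

Definition program (a b : nat) : cmd :=
  CSeq (CSeq (cpowers (a + b)) (CSeq (cquery a) (crows a b)))
    (CSeq (CISet 2 (ICst 0) (ICst 1))
       (CWhile (BILe (IVar 18) (ICst 0)) (cround b))).

Definition gval (R : realType) (s : memory R) (c : nat) : \bar R :=
  if imem s 6 c == 1%N then +oo%E else (rmem s 10 c)%:E.

(** A normal form: as an infinite ratio has value 0, two pairs of flag and value coincide exactly
    when the extended reals do, which [attainsE] relies on. *)
Definition gnorm (R : realType) (s : memory R) (c : nat) : Prop :=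
  imem s 6 c = 0%N \/ imem s 6 c = 1%N /\ rmem s 10 c = 0.

(** Equations between cells of one memory, free of any reference to a tree; [sums_tree] solves them
    at the nodes. *)
Definition sums_ok (R : realType) (K b o : nat) (s : memory R) (c : nat) : Prop :=
  let den := rmem s 6 c - rmem s 8 c in
  [/\ imem s 7 c = 0%N,
      rmem s 8 c = (if (1 <= imem s 3 (o + c))%N then rmem s 6 c
                    else \sum_(i < b) rmem s 8 (c + K ^ i)%N),
      rmem s 9 c = (if (1 <= imem s 3 (o + c))%N then 0
                    else rmem s 7 c + \sum_(i < b) rmem s 9 (c + K ^ i)%N),
      rmem s 10 c = rmem s 9 c / den
    & imem s 6 c = nat_of_bool ((den == 0) && (rmem s 9 c != 0))].

(** * Correctness of the backward pass *)

Section Rounds.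
Variables (R : realType) (tab : seq nat -> R) (acc N kappa : nat).
Local Notation wp := (@wp R tab acc N).
Local Notation K := kappa.+1.

Lemma le_ge_eq0 (x : R) : (x <= 0) && (0 <= x) = (x == 0).
Proof. by rewrite -eq_le. Qed.

Lemma cratio_spec v (s : memory R) : imem s 16 0 = v ->
  wp cratio (fun s' =>
    let den := rmem s 6 v - rmem s 8 v in
    [/\ rmem s' 10 v = rmem s 9 v / den,
        imem s' 6 v = nat_of_bool ((den == 0) && (rmem s 9 v != 0))
      & forall c, c != v -> rmem s' 10 c = rmem s 10 c /\ imem s' 6 c = imem s 6 c]) s.
Proof.
move=> s16; apply/wp_seq/wp_rset/wp_seq/wp_iset => /=.
apply: wp_if => /=; rewrite !updE /= s16 !le_ge_eq0 => h.
  apply: wp_iset; rewrite /= !updE /= s16 !eqxx h; split=> // c /negbTE cv.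
  by rewrite !updE /= ?s16 cv.
apply: wp_skip; rewrite /= !updE /= ?s16 !eqxx (negbTE h); split=> // c /negbTE cv.
by rewrite !updE /= ?s16 cv.
Qed.

Lemma csums_spec b o v (s : memory R) : imem s 16 0 = v -> imem s 19 0 = o ->
  (forall i, (i < b)%N -> imem s 4 i = (K ^ i)%N) ->
  wp (csums b) (fun s' =>
    [/\ rmem s' 8 v = (if (1 <= imem s 3 (o + v))%N then rmem s 6 v
                    else \sum_(i < b) rmem s 8 (v + K ^ i)%N),
      rmem s' 9 v = (if (1 <= imem s 3 (o + v))%N then 0
                    else rmem s 7 v + \sum_(i < b) rmem s 9 (v + K ^ i)%N)
    & forall c, c != v -> rmem s' 8 c = rmem s 8 c /\ rmem s' 9 c = rmem s 9 c]) s.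
Proof.
move=> s16 s19 pw; apply: wp_if => /=; rewrite s16 s19 => h.
  apply/wp_seq/wp_rset/wp_rset; rewrite /= !updE /= s16 !eqxx h.
  by split=> // c /negbTE cv; rewrite !updE /= ?s16 cv.
apply/wp_seq/wp_rset/wp_rset; rewrite /= !updE /= s16 !eqxx (negbTE h).
rewrite !reval_RSum /= s16; split.
- by apply: eq_bigr => i _; rewrite pw.
- by congr (_ + _); apply: eq_bigr => i _; rewrite !updE /= pw.
- by move=> c /negbTE cv; rewrite !updE /= cv.
Qed.

Lemma cbackward_spec b o (s : memory R) : powers_ok K b s -> (K ^ b <= N)%N ->
  imem s 19 0 = o ->
  wp (cbackward b) (fun s' => forall c, (c < K ^ b)%N -> sums_ok K b o s' c) s.
Proof.
move=> pw bN so.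
apply: (wp_for (n := (K ^ b)%N) (I := fun j s' =>
  forall c, (c < K ^ b <= c + j)%N -> sums_ok K b o s' c)) => //.
- by move=> s' f; rewrite /= (frame_i (k := 4) f) // pw.
- by move=> c /andP[]; rewrite addn0 ltnNge => /negbTE ->.
- move=> j s1 jb f s1j H; apply/wp_seq/wp_seq/wp_iset/wp_iset.
  rewrite /= !updE /= (frame_i (k := 4) f) // pw // s1j addn1.
  set v := (K ^ b - j.+1)%N; set s2 := set_i _ _ _ _.
  have s216 : imem s2 16 0 = v by rewrite /s2 /= !updE.
  have s219 : imem s2 19 0 = o by rewrite /s2 /= !updE /= (frame_i (k := 19) f).
  have pw2 i : (i < b)%N -> imem s2 4 i = (K ^ i)%N.
    by move=> ib; rewrite /s2 /= !updE /= (frame_i (k := 4) f) // pw // ltnW.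
  apply/wp_seq; apply: wp_mono (csums_spec s216 s219 pw2) => s3 f3 [h8 h9 h89].
  have s316 : imem s3 16 0 = v by rewrite (frame_i (k := 16) f3).
  apply: wp_mono (cratio_spec s316) => s4 f4 [h10 h6 h106].
  have r2 k : rmem s2 k = rmem s1 k by [].
  have e8 c : c != v -> rmem s4 8 c = rmem s1 8 c.
    by move=> cv; rewrite (frame_r (k := 8) f4) //; case: (h89 c cv) => ->.
  have e9 c : c != v -> rmem s4 9 c = rmem s1 9 c.
    by move=> cv; rewrite (frame_r (k := 9) f4) //; case: (h89 c cv) => _ ->.
  have e6 : rmem s4 6 = rmem s1 6 by rewrite (frame_r (k := 6) f4) // (frame_r (k := 6) f3).
  have e7 : rmem s4 7 = rmem s1 7 by rewrite (frame_r (k := 7) f4) // (frame_r (k := 7) f3).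
  have e3 : imem s4 3 = imem s1 3 by rewrite (frame_i (k := 3) f4) // (frame_i (k := 3) f3).
  have ei7 c : imem s4 7 c = if c == v then 0%N else imem s1 7 c.
    by rewrite (frame_i (k := 7) f4) // (frame_i (k := 7) f3).
  (* The cells of children lie above [v], so writing cell [v] preserves the equations already
     established. *)
  have up c i : (v <= c)%N -> (c + K ^ i)%N != v.
    move=> vc; have : (0 < K ^ i)%N by rewrite expn_gt0.
    by move=> h; apply/eqP; lia.
  move=> c /andP[cb cj]; rewrite /sums_ok /= !updE /=.
  have vc : (v <= c)%N by rewrite /v; lia.
  have sum8 : \sum_(i < b) rmem s4 8 (c + K ^ i)%N = \sum_(i < b) rmem s1 8 (c + K ^ i)%N.
    by apply: eq_bigr => i _; rewrite e8 // up.
  have sum9 : \sum_(i < b) rmem s4 9 (c + K ^ i)%N = \sum_(i < b) rmem s1 9 (c + K ^ i)%N.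
    by apply: eq_bigr => i _; rewrite e9 // up.
  rewrite sum8 sum9 e3 e6 e7 ei7; have [cv|cv] := eqVneq c v; last first.
    have [] := H c; first by rewrite cb /= /v in cv *; lia.
    rewrite e8 // e9 //; case: (h106 c cv) => -> ->.
    by rewrite (frame_r (k := 10) f3) // (frame_i (k := 6) f3).
  rewrite cv h10 h6 (frame_r (k := 8) f4) // (frame_r (k := 9) f4) // h8 h9.
  by rewrite (frame_r (k := 6) f3).
- by move=> s' _ H c cb; apply: H; rewrite cb leq_addl.
Qed.

End Rounds.

(** * Cells of the tables as quantities at nodes *)

Section RoundTree.
Variables (R : realType) (d : measure_display) (Om : measurableType d).
Variables (P : probability Om R) (A : finType) (Y : nat -> Om -> A) (S : Om -> nat).
Variables (kappa : nat) (c0 : A).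
Local Notation K := kappa.+1.
Local Notation comp := (composition kappa).

Definition stop_at (o : nat) (s : memory R) (y : seq A) : bool :=
  imem s 3 (o + comp y)%N == 1%N.

Lemma ext_comp (y : kappa.-bseq A) c : ext kappa y c = rcons y c :> seq A ->
  comp (ext kappa y c) = (comp y + K ^ letter c)%N.
Proof. by move=> ->; rewrite composition_rcons. Qed.

Lemma sum_letters (V : nmodType) (F : nat -> V) :
  \sum_(i < #|A|) F i = \sum_(c : A) F (letter c).
Proof. by rewrite (reindex (@enum_rank A)) //; apply: onW_bij; exact: enum_rank_bij. Qed.

Section State.
Variables (s : memory R) (o : nat) (h : seq A -> R).
Let T : {set kappa.-bseq A} := cut_tree kappa (stop_at o s).
Hypothesis stopk : forall y, size y = kappa -> stop_at o s y.
Hypothesis bits : forall c, (c < K ^ #|A|)%N -> (imem s 3 (o + c) <= 1)%N.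

Lemma bit_stop y : (size y <= kappa)%N -> (1 <= imem s 3 (o + comp y))%N = stop_at o s y.
Proof. by move=> yk; rewrite /stop_at; have := bits (composition_lt yk); lia. Qed.

Hypothesis sums : forall c, (c < K ^ #|A|)%N -> sums_ok K #|A| o s c.
Hypothesis b_succ : forall y, \sum_c b_ P Y S (rcons y c) = b_ P Y S y + h y.
Hypothesis s6 : forall y : seq A, (size y <= kappa)%N -> rmem s 6 (comp y) = a_ P Y S y.
Hypothesis s7 : forall y : seq A, (size y <= kappa)%N -> rmem s 7 (comp y) = h y.

(** Induction on the distance to depth [kappa], where every node is stopped. *)
Lemma sums_tree (y : kappa.-bseq A) : y \in T ->
  rmem s 8 (comp y) = \sum_(z in subtree_leaves T y) a_ P Y S z /\
  rmem s 9 (comp y) = \sum_(z in subtree_leaves T y) b_ P Y S z - b_ P Y S y.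
Proof.
move: {-2}(kappa - size y)%N (erefl (kappa - size y)%N) => n.
elim: n y => [|n IH] y yn yT; have yk := size_bseq y;
  have [_ e8 e9 _ _] := sums (composition_lt yk); rewrite e8 e9 bit_stop //.
- have sy : stop_at o s y by apply: stopk; lia.
  rewrite sy s6 // (subtree_leaves_stop c0 stopk); last by rewrite (leaves_cut c0 stopk) yT.
  by rewrite !big_set1 subrr.
- case: (boolP (stop_at o s y)) => sy.
    rewrite s6 // (subtree_leaves_stop c0 stopk); last by rewrite (leaves_cut c0 stopk) yT.
    by rewrite !big_set1 subrr.
  have yi : y \in internal T by rewrite (internal_cut c0 stopk) yT.
  rewrite !(subtree_leaves_go c0 stopk _ yi) s7 //.
  rewrite (sum_letters (fun i => rmem s 8 (comp y + K ^ i)%N)).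
  rewrite (sum_letters (fun i => rmem s 9 (comp y + K ^ i)%N)).
  have H c : rmem s 8 (comp y + K ^ letter c)%N =
        \sum_(z in subtree_leaves T (ext kappa y c)) a_ P Y S z /\
      rmem s 9 (comp y + K ^ letter c)%N =
        \sum_(z in subtree_leaves T (ext kappa y c)) b_ P Y S z - b_ P Y S (rcons y c).
    have [eT ee] := ext_cut c0 stopk c yi.
    rewrite -(ext_comp ee) -ee; apply: IH => //.
    by rewrite ee size_rcons; lia.
  split; first by apply: eq_bigr => c _; case: (H c).
  (* The terms of the children are relative to their own [b]; [b_succ] refers them to that of [y],
     and the [h y] added by the program cancels. *)
  under eq_bigr do rewrite (proj2 (H _)).
  rewrite sumrB b_succ addrCA; congr (_ + _).
  by rewrite opprD addrCA subrr addr0.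
Qed.

Lemma g_tree (y : kappa.-bseq A) : y \in internal T -> g_ P Y S T y = gval s (comp y).
Proof.
rewrite (internal_cut c0 stopk) => /andP[yT _]; have yk := size_bseq y.
have [e8 e9] := sums_tree yT; have [_ _ _ e10 e6] := sums (composition_lt yk).
rewrite /g_ /gval e6 e10 s6 // -e8 -e9; case: eqP => //= d0.
by case: eqP => [->|_] /=; rewrite ?mul0r.
Qed.

Lemma gnorm_tree c : (c < K ^ #|A|)%N -> gnorm s c.
Proof.
move=> /sums[_ _ _ e10 e6]; rewrite /gnorm e6 e10; case: eqP => [->|_] /=; last by left.
by case: eqP => [->|_]; rewrite invr0 mulr0; [left|right].
Qed.

End State.

Lemma improvesE (s : memory R) : let c := imem s 12 0 in let m := imem s 17 0 in
  gnorm s c -> gnorm s m -> beval s improves = (gval s m < gval s c)%E.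
Proof.
move=> c m; rewrite /= -/c -/m /gval => -[->|[-> ->]] [->|[-> ->]] /=.
- by rewrite lte_fin ltNge.
- by rewrite ltNge leey.
- by rewrite ltry.
- by rewrite ltxx.
Qed.

Lemma attainsE (s : memory R) : let c := imem s 12 0 in let m := imem s 17 0 in
  gnorm s c -> gnorm s m -> beval s attains = (gval s c == gval s m).
Proof.
move=> c m; rewrite /= -/c -/m /gval -eq_le => -[->|[-> ->]] [->|[-> ->]] //=.
by rewrite !eqxx.
Qed.

Section Wp.
Variables (tab : seq nat -> R) (acc N : nat).
Local Notation wp := (@wp R tab acc N).

Definition selected (T : {set kappa.-bseq A}) (s : memory R) : Prop :=
  [/\ forall y, y \in T -> imem s 7 (comp y) = 1%N,
      forall c, (c < K ^ #|A|)%N -> (1 <= imem s 7 c)%N ->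
        exists2 y, y \in T & comp y = c
    & [bseq] \in internal T ->
      exists y0, [/\ y0 \in internal T, comp y0 = imem s 17 0 &
        forall y, y \in internal T -> (gval s (comp y) <= gval s (comp y0))%E]].

(** Describes the nodes whose membership has been recorded when the ascending sweep arrives at
    [i]. *)
Definition preceded (i : nat) (y : seq A) : Prop :=
  y = [::] \/ exists y' c, y = rcons y' c /\ (comp y' < i)%N.

Lemma cforward_spec o (s : memory R) : let T := cut_tree kappa (stop_at o s) in
  powers_ok K #|A| s -> (K ^ #|A| <= N)%N -> imem s 19 0 = o ->
  (forall y, size y = kappa -> stop_at o s y) ->
  (forall c, (c < K ^ #|A|)%N -> (imem s 3 (o + c) <= 1)%N) ->
  (forall c, (c < K ^ #|A|)%N -> imem s 7 c = 0%N) ->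
  (forall c, (c < K ^ #|A|)%N -> gnorm s c) ->
  wp (cforward #|A|) (selected T) s.
Proof.
move=> T pw bN so stopk bits z7 gn.
have fu k : k \notin [:: 7; 12; 17]%N -> untouched_i k (cforward #|A|).
  rewrite !inE !negb_or => /and3P[h1 h2 h3] /=.
  by rewrite h1 h2 h3 untouched_i_CSeqs.
apply/wp_frame/wp_seq/wp_seq/wp_iset/wp_iset => /=; set s0 := set_i _ _ _ _.
have comp0 : comp ([::] : seq A) = 0%N by exact: composition_nil.
apply: (wp_for (n := (K ^ #|A|)%N) (I := fun i s' =>
  [/\ forall y : kappa.-bseq A, y \in T -> preceded i y -> imem s' 7 (comp y) = 1%N,
      forall c, (c < K ^ #|A|)%N -> (1 <= imem s' 7 c)%N ->
        exists2 y, y \in T & comp y = c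
    & [bseq] \in internal T ->
      exists y0 : kappa.-bseq A, [/\ y0 \in internal T, comp y0 = imem s' 17 0 &
        forall y : kappa.-bseq A, y \in internal T -> (comp y < i)%N ->
          (gval s (comp y) <= gval s (comp y0))%E]])) => //.
- by rewrite /= untouched_i_CSeqs.
- by move=> s' f; rewrite /= (frame_i (k := 4) f) /= ?untouched_i_CSeqs // /s0 /= !updE /= pw.
- split.
  + by move=> y yT [->|[y' [c [_]]]] //; rewrite comp0.
  + move=> c cb; rewrite /s0 /= !updE /=; case: eqP => [-> _|_]; last by rewrite z7.
    by exists [bseq]; [exact: nil_cut|].
  + by move=> i0; exists [bseq]; split.
- move=> i s1 ib f s1i [H1 H2 H3].
  have f3 : imem s1 3 = imem s 3 by rewrite (frame_i (k := 3) f) /= ?untouched_i_CSeqs.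
  have f4 j : (j <= #|A|)%N -> imem s1 4 j = (K ^ j)%N.
    by move=> ja; rewrite (frame_i (k := 4) f) /= ?untouched_i_CSeqs // /s0 /= !updE /= pw.
  have f19 : imem s1 19 0 = o by rewrite (frame_i (k := 19) f) /= ?untouched_i_CSeqs.
  have f6 : imem s1 6 = imem s 6 by rewrite (frame_i (k := 6) f) /= ?untouched_i_CSeqs.
  have f10 : rmem s1 10 = rmem s 10 by rewrite (frame_r (k := 10) f) /= ?untouched_r_CSeqs.
  apply: wp_if => [|nact].
    rewrite /= s1i f19 f3 => /andP[r1 b0].
    (* Being internal depends on the composition only, so any node of composition [i] may represent
       it. *)
    have [y yT yi] := H2 _ ib r1.
    have yint : y \in internal T.
      by rewrite (internal_cut c0 stopk) yT /stop_at yi; move: b0; lia.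
    have ns : [bseq] \in internal T.
      rewrite (internal_cut c0 stopk) nil_cut /=.
      have [/size0nil y0|] := posnP (size y).
        by move: yint; rewrite (internal_cut c0 stopk) => /andP[_]; rewrite y0.
      by move: yT; rewrite inE => /reachedP h /h; rewrite take0.
    apply/wp_seq/(wp_seqs (I := fun j s' => [/\ imem s' 12 0 = i,
      imem s' 17 0 = imem s1 17 0, forall c, imem s1 7 c = 1%N -> imem s' 7 c = 1%N,
      forall e, (e < j)%N -> imem s' 7 (i + K ^ e) = 1%N &
      forall c, imem s' 7 c = imem s1 7 c \/ exists2 e, (e < j)%N & c = (i + K ^ e)%N])) => //.
    + by split => // c; left.
    + move=> j s2 ja f2 [h1 h2 h3 h4 h5]; apply: wp_iset => /=.
      rewrite !updE /= h1 (frame_i (k := 4) f2) ?untouched_i_CSeqs // f4 ?(ltnW ja) //; split => //.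
      * by move=> c /h3; rewrite !updE /=; case: eqP.
      * move=> e; rewrite ltnS leq_eqVlt updE => /predU1P[->|ej]; first by rewrite !eqxx.
        by rewrite h4 //; case: ifP.
      * move=> c; rewrite updE /=; case: eqP => [->|_]; first by right; exists j.
        by case: (h5 c) => [|[e ej ->]]; [left|right; exists e => //; exact: ltnW].
    + move=> s2 f2 [h1 h2 h3 h4 h5].
      have H1' (z : kappa.-bseq A) : z \in T -> preceded i.+1 z -> imem s2 7 (comp z) = 1%N.
        move=> zT [z0|[z' [c [zE]]]]; first by apply/h3/H1 => //; left.
        rewrite ltnS leq_eqVlt => /predU1P[z'i|z'i].
          by rewrite zE composition_rcons z'i; apply: h4; exact: letter_lt.
        by apply/h3/H1 => //; right; exists z', c.
      have H2' c : (c < K ^ #|A|)%N -> (1 <= imem s2 7 c)%N -> exists2 y, y \in T & comp y = c.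
        case: (h5 c) => [->|[e eb ->] _ _]; first exact: H2.
        have [w wE] : exists w : A, letter w = e.
          by exists (enum_val (Ordinal eb)); rewrite /letter enum_valK.
        have [eT ee] := ext_cut c0 stopk w yint.
        by exists (ext kappa y w); rewrite // (ext_comp ee) wE yi.
      have [y0 [y0i y0c y0m]] := H3 ns.
      have y0k : (comp y0 < K ^ #|A|)%N by apply/composition_lt/size_bseq.
      have g2 c : gval s2 c = gval s c.
        rewrite /gval (frame_i (k := 6) f2) ?untouched_i_CSeqs //.
        by rewrite (frame_r (k := 10) f2) ?untouched_r_CSeqs // f6 f10.
      have n2 c : (c < K ^ #|A|)%N -> gnorm s2 c.
        move=> cb; rewrite /gnorm (frame_i (k := 6) f2) ?untouched_i_CSeqs //.
        by rewrite (frame_r (k := 10) f2) ?untouched_r_CSeqs // f6 f10; exact: gn.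
      have iE : beval s2 improves = (gval s (comp y0) < gval s i)%E.
        rewrite improvesE ?h1 ?h2 -?y0c ?g2 //; exact: n2.
      apply: wp_if; rewrite iE => hlt.
        apply: wp_iset; rewrite /= !updE /= h1; split.
        * by move=> z zT /(H1' _ zT); rewrite !updE.
        * by move=> c cb; rewrite !updE /=; exact: H2'.
        * move=> _; exists y; split => // z zi; rewrite ltnS leq_eqVlt yi => /predU1P[->//|zlt].
          by apply: le_trans (y0m _ zi zlt) (ltW hlt).
      apply: wp_skip; split.
      * by move=> z zT /(H1' _ zT); rewrite /= !updE.
      * by move=> c cb; rewrite /= !updE /=; exact: H2'.
      * move=> _; exists y0; rewrite /= !updE /= h2; split => // z zi.
        rewrite ltnS leq_eqVlt => /predU1P[->|zlt]; last exact: y0m.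
        by rewrite leNgt.
  (* When the test fails, no internal node has composition [i]: its flag would be set by [H1], and
     its mark would be absent. *)
  have act (y : kappa.-bseq A) : y \in internal T -> comp y = i -> preceded i y -> False.
    rewrite (internal_cut c0 stopk) => /andP[yT ns] yi yp; move/negP: nact; apply.
    rewrite /= s1i f19 f3 -yi (H1 y yT yp) /=.
    by move: ns (bits (comp y) (composition_lt (size_bseq y))); rewrite /stop_at; lia.
  have prec (y : kappa.-bseq A) : comp y = i -> preceded i y.
    move=> yi; case: (lastP y) yi => [|y' c]; first by left.
    rewrite composition_rcons => yi; right; exists y', c; split => //.
    by rewrite -yi -[X in (X < _)%N]addn0 ltn_add2l expn_gt0.
  apply: wp_skip; split.
  + move=> y yT [y0|[y' [c [yE]]]]; rewrite /= !updE /=; first by apply: H1 => //; left.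
    rewrite ltnS leq_eqVlt => /predU1P[y'i|y'i]; last by apply: H1 => //; right; exists y', c.
    have [z zE zT] := take_cut (size y') yT.
    rewrite yE -cats1 take_size_cat // in zE.
    case: (act z); rewrite ?zE //.
      rewrite (internal_cut c0 stopk) zT zE; move: yT; rewrite inE yE reached_rcons.
      by case/andP.
    by rewrite -zE; apply: prec; rewrite zE.
  + by move=> c cb; rewrite /= !updE /=; exact: H2.
  + move=> ns; have [y0 [y0i y0c y0m]] := H3 ns; exists y0; rewrite /= !updE /=; split => // y yi.
    rewrite ltnS leq_eqVlt => /predU1P[yE|]; last exact: y0m.
    by case: (act y) => //; exact: prec.
- move=> s1 f [H1 H2 H3] F; split => //.
  + move=> y yT; apply: H1 => //; case: (lastP y) yT (size_bseq y) => [|y' c]; first by left.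
    move=> _ yk; right; exists y', c; split => //; apply: composition_lt.
    by move: yk; rewrite size_rcons => /ltnW.
  + move=> ns; have [y0 [y0i y0c y0m]] := H3 ns; exists y0; split => // y yi.
    have G c : gval s1 c = gval s c.
      rewrite /gval (frame_i (k := 6) F) ?fu // (frame_r (k := 10) F) //=.
      by rewrite untouched_r_CSeqs.
    by rewrite !G; apply: y0m => //; apply/composition_lt/size_bseq.
Qed.

End Wp.
End RoundTree.

Lemma cut_tree_ext kappa (A : finType) (stop stop' : pred (seq A)) :
  (forall y, (size y <= kappa)%N -> stop y = stop' y) ->
  cut_tree kappa stop = cut_tree kappa stop'.
Proof.
move=> e; apply/finset.setP => y; rewrite !inE; apply: eq_in_all => n.
rewrite mem_iota add0n /= => ny; rewrite e // size_takel ?(ltnW ny) //.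
exact: leq_trans (ltnW ny) (size_bseq y).
Qed.

(** * Invariant of the rounds *)

Section Round.
Variables (R : realType) (d : measure_display) (Om : measurableType d).
Variables (P : probability Om R) (A : finType) (Y : nat -> Om -> A) (S : Om -> nat).
Variables (kappa : nat) (c0 : A) (h : seq A -> R).
Variables (tab : seq nat -> R) (acc N : nat).
Local Notation K := kappa.+1.
Local Notation comp := (composition kappa).
Local Notation Ny := (kappa.+1 ^ #|A|)%N.
Local Notation wp := (@wp R tab acc N).
Local Notation stop_at := (@stop_at R A kappa).

Lemma cupdate_spec o (s : memory R) :
  powers_ok K #|A| s -> (Ny <= N)%N -> imem s 19 0 = o ->
  (forall c, (c < Ny)%N -> gnorm s c) -> (imem s 17 0 < Ny)%N ->
  wp (cupdate #|A|) (fun s' =>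
    (forall c, (c < Ny)%N -> imem s' 3 (o + Ny + c) =
       if [&& 1 <= imem s 7 c, imem s 3 (o + c) <= 0 &
             gval s c == gval s (imem s 17 0)]%N then 1%N else imem s 3 (o + c)) /\
    (forall k, (k < o + Ny)%N -> imem s' 3 k = imem s 3 k)) s.
Proof.
move=> pw bN so gn mN.
apply: (wp_for (n := Ny) (I := fun i s' =>
    (forall c, (c < i)%N -> imem s' 3 (o + Ny + c) =
       if [&& 1 <= imem s 7 c, imem s 3 (o + c) <= 0 &
             gval s c == gval s (imem s 17 0)]%N then 1%N else imem s 3 (o + c)) /\
    (forall k, (k < o + Ny)%N -> imem s' 3 k = imem s 3 k))) => //.
- by move=> s' f; rewrite /= (frame_i (k := 4) f) // pw.
- move=> c s1 cN f s1c [H1 H2].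
  have f4 : imem s1 4 #|A| = Ny by rewrite (frame_i (k := 4) f) // pw.
  have f19 : imem s1 19 0 = o by rewrite (frame_i (k := 19) f).
  have f7 : imem s1 7 = imem s 7 by rewrite (frame_i (k := 7) f).
  have f17 : imem s1 17 = imem s 17 by rewrite (frame_i (k := 17) f).
  have f6 : imem s1 6 = imem s 6 by rewrite (frame_i (k := 6) f).
  have f10 : rmem s1 10 = rmem s 10 by rewrite (frame_r (k := 10) f).
  have g1 e : gval s1 e = gval s e by rewrite /gval f6 f10.
  have n1 e : (e < Ny)%N -> gnorm s1 e by move=> eN; rewrite /gnorm f6 f10; exact: gn.
  have bc : imem s1 3 (o + c) = imem s 3 (o + c) by rewrite H2 // ltn_add2l.
  have bE : beval s1 (BAnd active attains) =
     [&& 1 <= imem s 7 c, imem s 3 (o + c) <= 0 & gval s c == gval s (imem s 17 0)]%N.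
    rewrite -[beval _ _]/(beval s1 active && beval s1 attains).
    rewrite attainsE ?s1c ?f17 ?g1; [|exact: n1|exact: n1].
    by rewrite -andbA /= s1c f19 f7 bc.
  have step v : v = (if [&& 1 <= imem s 7 c, imem s 3 (o + c) <= 0 &
             gval s c == gval s (imem s 17 0)]%N then 1%N else imem s 3 (o + c)) ->
      (forall c', (c' < c.+1)%N -> upd (imem s1) 3 (o + Ny + c) v 3 (o + Ny + c')%N =
       if [&& 1 <= imem s 7 c', imem s 3 (o + c') <= 0 &
             gval s c' == gval s (imem s 17 0)]%N then 1%N else imem s 3 (o + c')) /\
    (forall k, (k < o + Ny)%N -> upd (imem s1) 3 (o + Ny + c) v 3 k = imem s 3 k).
    move=> ->; split=> [c'|k kN].
      rewrite ltnS leq_eqVlt updE /= => /predU1P[->|c'c]; first by rewrite eqxx.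
      by rewrite eqn_add2l ltn_eqF // H1.
    by rewrite updE /= ltn_eqF ?H2 // ltn_addr.
  apply: wp_if; rewrite bE => hb; apply: wp_iset; rewrite /= f19 f4 s1c.
    by have [h1 h2] := step 1%N (esym (ifT _ _ hb)); split=> [c' /h1|k /h2]; rewrite !updE.
  have [h1 h2] := step _ (esym (ifN _ _ hb)); rewrite bc.
  by split=> [c' /h1|k /h2]; rewrite !updE.
Qed.

(** The measure of progress: its cardinal is at most [Ny] and grows strictly at each round that does
    not stop. *)
Definition ones (o : nat) (s : memory R) : {set 'I_Ny} :=
  [set c : 'I_Ny | imem s 3 (o + c)%N == 1%N]%SET.

Definition base_ok (s : memory R) : Prop :=
  [/\ powers_ok K #|A| s,
      forall y : seq A, (size y <= kappa)%N -> rmem s 6 (comp y) = a_ P Y S y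
    & forall y : seq A, (size y <= kappa)%N -> rmem s 7 (comp y) = h y].

Definition lambda_ok (r : nat) (s : memory R) : Prop :=
  forall m, (m <= r)%N -> algo_lambda P kappa Y S m =
    (if imem s 2 m == 1%N then +oo%E else (rmem s 1 m)%:E).

(** The current tree, of index [r], is left out because its values are written in the following
    round. *)
Definition alpha_d_ok (r : nat) (s : memory R) : Prop :=
  forall m, (1 <= m < r)%N ->
    rmem s 2 m = algo_alpha P kappa Y S m /\ rmem s 3 m = algo_d P kappa Y S m.

Definition trees_ok (r : nat) (s : memory R) : Prop :=
  forall m, (m <= r)%N ->
    [/\ forall c, (c < Ny)%N -> (imem s 3 (m * Ny + c) <= 1)%N,
        forall y : seq A, size y = kappa -> stop_at (m * Ny) s y
      & algo_tree P kappa Y S m = cut_tree kappa (stop_at (m * Ny) s)].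

Definition round_inv (r : nat) (s : memory R) : Prop :=
  [/\ [/\ imem s 1 0 = r, imem s 19 0 = (r * Ny)%N & imem s 18 0 = 0%N],
      reaches P kappa Y S r, trees_ok r s, lambda_ok r s /\ alpha_d_ok r s
    & (r <= #|ones (r * Ny) s|)%N].

Definition final_state (s : memory R) : Prop :=
  imem s 18 0 = 1%N /\
  exists M, last_index P kappa Y S M /\ output P kappa Y S M s.

Hypothesis b_succ : forall y, \sum_c b_ P Y S (rcons y c) = b_ P Y S y + h y.
Hypothesis b_nil : b_ P Y S [::] = 0.
Hypothesis tree_a : forall stop : pred (seq A), (forall y, size y = kappa -> stop y) ->
  Pr P [set w | (tree_time Y (cut_tree kappa stop) w < S w)%N] =
  \sum_(z in leaves (cut_tree kappa stop)) a_ P Y S z.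
Hypothesis tree_b : forall stop : pred (seq A), (forall y, size y = kappa -> stop y) ->
  fine 'E_P[fun w => (tree_time Y (cut_tree kappa stop) w - S w)%N%:R] =
  \sum_(z in leaves (cut_tree kappa stop)) b_ P Y S z.

Lemma beval_nonzero (s : memory R) : gnorm s (imem s 17 0) ->
  beval s nonzero = (gval s (imem s 17 0) != 0%E).
Proof.
by rewrite /= le_ge_eq0 /gval => -[->|[-> _]].
Qed.

Lemma cround_untouched_i k : k \notin [:: 1; 2; 3; 6; 7; 12; 15; 16; 17; 18; 19]%N ->
  untouched_i k (cround #|A|).
Proof.
rewrite !inE !negb_or => H; move: H; do ![case/andP => ?] => ?.
rewrite /=; do ?[apply/andP; split] => //; exact: untouched_i_CSeqs.
Qed.

Lemma cround_untouched_r k : k \notin [:: 1; 2; 3; 8; 9; 10]%N ->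
  untouched_r k (cround #|A|).
Proof.
rewrite !inE !negb_or => H; move: H; do ![case/andP => ?] => ?.
rewrite /=; do ?[apply/andP; split] => //; exact: untouched_r_CSeqs.
Qed.

Lemma cround_spec r (s : memory R) : (Ny <= N)%N -> base_ok s -> round_inv r s ->
  wp (cround #|A|) (fun s' => round_inv r.+1 s' \/ final_state s') s.
Proof.
move=> bN [pw s6 s7] [[s1r s19 s18] rr tr [lam ald] cnt].
have [bits stopk TE] := tr r (leqnn r).
set o := (r * Ny)%N in s19 bits stopk TE cnt *.
set T := cut_tree kappa (stop_at o s) in TE *.
apply: wp_seq; apply: wp_mono (cbackward_spec tab acc pw bN s19) => s1 f1 sums.
have e3 : imem s1 3 = imem s 3 by rewrite (frame_i (k := 3) f1).
have se1 : stop_at o s1 = stop_at o s by apply/funext => y; rewrite /stop_at e3.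
have stopk1 y : size y = kappa -> stop_at o s1 y by rewrite se1; exact: stopk.
have bits1 c : (c < Ny)%N -> (imem s1 3 (o + c) <= 1)%N by rewrite e3; exact: bits.
have s16 y : (size y <= kappa)%N -> rmem s1 6 (comp y) = a_ P Y S y.
  by rewrite (frame_r (k := 6) f1) //; exact: s6.
have s17 y : (size y <= kappa)%N -> rmem s1 7 (comp y) = h y.
  by rewrite (frame_r (k := 7) f1) //; exact: s7.
have st := sums_tree c0 stopk1 bits1 sums b_succ s16 s17.
have gt := g_tree c0 stopk1 bits1 sums b_succ s16 s17.
have gn := gnorm_tree sums.
rewrite se1 -/T in st gt.
have comp0 : comp ([::] : seq A) = 0%N by exact: composition_nil.
have s11 : imem s1 1 0 = r by rewrite (frame_i (k := 1) f1).
apply/wp_seq/wp_seq/wp_rset/wp_rset; rewrite /= !updE /= s11.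
set s2 := set_r _ _ _ _.
have se2 : stop_at o s2 = stop_at o s by rewrite -se1.
have pw2 : powers_ok K #|A| s2.
  by move=> i ia; rewrite /s2 /= (frame_i (k := 4) f1) // pw.
have s219 : imem s2 19 0 = o by rewrite /s2 /= (frame_i (k := 19) f1).
have z7 c : (c < Ny)%N -> imem s2 7 c = 0%N by move=> /sums[].
have gn2 c : (c < Ny)%N -> gnorm s2 c by exact: gn.
apply: wp_seq.
apply: wp_mono (cforward_spec c0 tab acc pw2 bN s219 _ bits1 z7 gn2) => [s3 f3|y yk];
  last first.
  by rewrite se2; exact: stopk.
rewrite se2 -/T => -[q1 q2 q3].
have fi k : k \notin [:: 7; 12; 17]%N -> imem s3 k = imem s1 k.
  rewrite !inE !negb_or => /and3P[k1 k2 k3].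
  by rewrite (frame_i f3) //= k1 k2 k3 untouched_i_CSeqs.
have fr k : rmem s3 k = rmem s2 k.
  by rewrite (frame_r f3) //= untouched_r_CSeqs.
have g3 c : gval s3 c = gval s1 c by rewrite /gval fi // fr.
have g2 c : gval s2 c = gval s1 c by [].
have gn3 c : (c < Ny)%N -> gnorm s3 c.
  by move=> cN; rewrite /gnorm fi // fr; exact: gn.
have s31 : imem s3 1 0 = r by rewrite fi.
have s319 : imem s3 19 0 = o by rewrite fi.
have e33 : imem s3 3 = imem s 3 by rewrite fi.
have root_stop : (1 <= imem s3 3 (imem s3 19 0))%N = stop_at o s [::].
  by rewrite e33 s319 -(bit_stop bits) // comp0 addn0.
have ad : alpha_d_ok r.+1 s3.
  move=> m /andP[m0]; rewrite ltnS leq_eqVlt => /predU1P[mr|mr].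
    have r2 : rmem s3 2 m = rmem s1 8 0%N by rewrite fr /s2 /= !updE /= mr eqxx.
    have r3 : rmem s3 3 m = rmem s1 9 0%N by rewrite fr /s2 /= !updE /= mr eqxx.
    (* Since [b] vanishes at the root, the difference stored there is the full sum of [b] over the
       leaves. *)
    have /= := st _ (nil_cut kappa (stop_at o s)); rewrite comp0 b_nil subr0 => -[e8 e9].
    rewrite r2 r3 mr /algo_alpha /algo_d TE tree_a // tree_b // leaves_subtree.
    by rewrite e8 e9.
  have m1r : (1 <= m < r)%N by rewrite m0.
  have [h2 h3] := ald m m1r.
  by rewrite !fr /s2 /= !updE /= (ltn_eqF mr) (frame_r (k := 2) f1) // (frame_r (k := 3) f1).
have trees3 : trees_ok r s3.
  move=> m mr; have [t1 t2 t3] := tr m mr; split=> [c cN|y yk|].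
  - by rewrite e33; exact: t1.
  - by rewrite /stop_at e33; exact: t2.
  - by rewrite t3; congr cut_tree; apply/funext => y; rewrite /stop_at e33.
have lam3 : lambda_ok r s3.
  move=> m mr; rewrite lam // fi // fr /s2 /= !updE /=.
  by rewrite (frame_i (k := 2) f1) // (frame_r (k := 1) f1).
have rootT : (stop_at o s [::] = false) -> [bseq] \in internal T.
  by move=> sr; rewrite (internal_cut c0 stopk) nil_cut sr.
have lamE : algo_lambda P kappa Y S r.+1 = max_g P Y S T by rewrite /= TE.
have sel : stop_at o s [::] = false -> exists y0 : kappa.-bseq A,
    [/\ y0 \in internal T, comp y0 = imem s3 17 0,
        max_g P Y S T = g_ P Y S T y0 & g_ P Y S T y0 = gval s3 (imem s3 17 0)].
  move=> sr; have [y0 [y0i y0c y0m]] := q3 (rootT sr).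
  exists y0; split => //; last by rewrite gt // -y0c g3.
  by apply: (max_gE c0 stopk) => // y yi; rewrite !gt //; rewrite -!g3; exact: y0m.
apply: wp_if.
  rewrite -[beval _ _]/(~~ (1 <= imem s3 3 (imem s3 19 0))%N && beval s3 nonzero).
  rewrite root_stop => /andP[/negbTE sr nz].
  have [y0 [y0i y0c mg g0]] := sel sr.
  have y0N : (imem s3 17 0 < Ny)%N by rewrite -y0c; apply/composition_lt/size_bseq.
  rewrite beval_nonzero in nz; last exact: gn3.
  apply/wp_seq/wp_seq/wp_iset/wp_seq/wp_iset/wp_rset.
  rewrite /= !updE /= s31 addn1; set s4 := set_r _ _ _ _.
  have pw4 : powers_ok K #|A| s4.
    by move=> i ia; rewrite /s4 /= !updE /= fi // pw2.
  have s419 : imem s4 19 0 = o by rewrite /s4 /= !updE /= fi.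
  have gn4 c : (c < Ny)%N -> gnorm s4 c.
    by move=> cN; rewrite /gnorm /s4 /= !updE /=; exact: gn3.
  have s417 : imem s4 17 0 = imem s3 17 0 by rewrite /s4 /= !updE.
  have g4 c : gval s4 c = gval s1 c by rewrite -g3 /gval /s4 /= !updE.
  apply/wp_seq; apply: wp_mono (cupdate_spec pw4 bN s419 gn4 _) => [s5 f5 [u1 u2]|]; last first.
    by rewrite s417.
  have i43 : imem s4 3 = imem s 3 by rewrite /s4 /= upd_neq // upd_neq.
  have i47 c : imem s4 7 c = imem s3 7 c by rewrite /s4 /= !updE.
  rewrite s417 !g4 i43 in u1; rewrite i43 in u2.
  apply: wp_iset; left; set s6' := set_i _ _ _ _.
  have E : (r.+1 * Ny = o + Ny)%N by rewrite mulSn addnC.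
  have i63 k : imem s6' 3 k = imem s5 3 k by rewrite /s6' /= updE.
  have old m c : (m <= r)%N -> (c < Ny)%N -> imem s6' 3 (m * Ny + c) = imem s 3 (m * Ny + c).
    move=> mr cN; rewrite i63 u2 //.
    rewrite /o -mulSnr (leq_trans (_ : _ < m.+1 * Ny)%N) //.
      by rewrite mulSnr ltn_add2l.
    by rewrite leq_mul2r ltnS mr orbT.
  have newv c : (c < Ny)%N -> imem s6' 3 (r.+1 * Ny + c) =
      if [&& (1 <= imem s3 7 c)%N, (imem s 3 (o + c) <= 0)%N & gval s1 c == gval s1 (imem s3 17 0)]
      then 1%N else imem s 3 (o + c).
    by move=> cN; rewrite i63 E u1 // g4 i47.
  have up c : (c < Ny)%N -> imem s 3 (o + c) = 1%N -> imem s6' 3 (r.+1 * Ny + c) = 1%N.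
    by move=> cN b1; rewrite newv // b1 ; case: ifP.
  (* At internal nodes the new marks are those of the nodes attaining the maximum, and by [up] old
     marks persist: these are the two hypotheses of [prune_cut]. *)
  have int_stop (y : kappa.-bseq A) : y \in internal T ->
      stop_at (r.+1 * Ny) s6' y = (g_ P Y S T y == max_g P Y S T).
    move=> yi; have := yi; rewrite (internal_cut c0 stopk) => /andP[yT ny].
    have yN := composition_lt (size_bseq y).
    have b0 : imem s 3 (o + comp y) = 0%N.
      by move: ny (bits _ yN); rewrite /stop_at; lia.
    by rewrite /stop_at newv // q1 // b0 /= mg g0 gt // g3; case: ifP.
  split.
  - split; first by rewrite /s6' /= !updE /= (frame_i (k := 1) f5) // /s4 /= !updE.
      rewrite /s6' /= !updE /= (frame_i (k := 19) f5) // (frame_i (k := 4) f5) //.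
      by rewrite s419 pw4.
    rewrite /s6' /= !updE /= (frame_i (k := 18) f5) // /s4 /= !updE /= fi //.
    by rewrite (frame_i (k := 18) f1).
  - move=> k /andP[k0]; rewrite leq_eqVlt => /predU1P[->|kr]; last by apply: rr; rewrite k0.
    by rewrite lamE mg g0; apply/eqP.
  - move=> m; rewrite leq_eqVlt => /predU1P[->|mr].
      split=> [c cN|y yk|].
      + by rewrite newv //; case: ifP => // _; exact: bits.
      + rewrite /stop_at up //; first by apply: composition_lt; rewrite yk.
        by apply/eqP; exact: stopk.
      + rewrite -(@prune_cut _ _ c0 _ stopk _ (fun y => g_ P Y S T y == max_g P Y S T)) //.
          by rewrite /= TE.
        move=> y _ sy; rewrite /stop_at up //; last exact/eqP.
        exact/composition_lt/size_bseq.
    have [t1 t2 t3] := tr m mr; split=> [c cN|y yk|].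
    + by rewrite old //; exact: t1.
    + by rewrite /stop_at old //; [exact: t2|apply: composition_lt; rewrite yk].
    + rewrite t3; apply: cut_tree_ext => y yk; rewrite /stop_at old //.
      exact: composition_lt.
  - split=> m.
      rewrite leq_eqVlt /s6' /= !updE /= (frame_i (k := 2) f5) // (frame_r (k := 1) f5) //.
      rewrite /s4 /= !updE /= => /predU1P[->|mr].
        by rewrite !eqxx lamE mg g0 /gval.
      by rewrite !(ltn_eqF mr) -lam3.
    move=> /ad; rewrite /s6' /= (frame_r (k := 2) f5) // (frame_r (k := 3) f5) //.
  (* Strict growth: the maximizing node [y0] is internal, so its composition was unmarked, and now
     it is marked. *)
  - apply: leq_ltn_trans cnt _; apply: proper_card; apply/properP; split.
      by apply/fintype.subsetP => c; rewrite !inE => /eqP /(up _ (ltn_ord c)) ->.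
    rewrite -y0c in y0N; exists (Ordinal y0N).
      rewrite inE /=; have := int_stop _ y0i; by rewrite mg eqxx.
    by rewrite inE /=; move: y0i; rewrite (internal_cut c0 stopk) => /andP[].
rewrite -[beval _ _]/(~~ (1 <= imem s3 3 (imem s3 19 0))%N && beval s3 nonzero).
rewrite root_stop => ns; apply: wp_iset; right; split; first by rewrite /= updE.
exists r; split.
  (* Either the root is marked and the maximum is 0 by convention, or the test has found the maximum
     equal to 0. *)
  split => //; rewrite lamE; case sr : (stop_at o s [::]).
    by apply: max_g_root.
  have [y0 [y0i y0c mg g0]] := sel sr; rewrite mg g0; apply/eqP.
  move: ns; rewrite sr beval_nonzero; first by rewrite negbK.
  by apply: gn3; rewrite -y0c; apply/composition_lt/size_bseq.
split=> //=; rewrite ?updE //=.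
move=> m y mr yT; have [t1 t2 t3] := trees3 m mr.
by rewrite updE /= t3 in yT *; rewrite (leaves_cut c0 t2) yT.
Qed.

End Round.

(** * Correctness and running time of the whole program *)

Section Main.
Variables (R : realType) (d : measure_display) (Om : measurableType d).
Variables (P : probability Om R) (XT YT : finType).
Variables (X : nat -> Om -> XT) (Y : nat -> Om -> YT) (S : Om -> nat) (kappa : nat).
Hypothesis kappa_gt0 : (1 <= kappa)%N.
Hypothesis XYiid : iid P (fun i w => (X i w, Y i w)).
Hypothesis Sdisc : discrete_rv S.
Hypothesis indep : independent_randomization P X Y S.
Hypothesis S_gt0 : forall w, (1 <= S w)%N.
Hypothesis S_perm : permutation_invariant P kappa X S.
Local Notation K := kappa.+1.
Local Notation comp := (composition kappa).
Local Notation tab := (S_list P kappa X S).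
(** Dominates the passes of all loops: [K] for the powers, [K ^ #|XT|] and [K ^ #|YT|] for the
    sweeps, and at most [K ^ #|YT|] plus one rounds, for which the successor in the exponent leaves
    room. *)
Let N := (K ^ (#|XT| + #|YT|).+1)%N.
Variable acc : nat.
Local Notation wp := (@wp R tab acc N).
Let h (y : seq YT) : R := Pr P ([set w | (S w <= size y)%N] `&` starts_with Y y).

(** A probability space is not empty, and [Y] takes a letter at any of its points. *)
Lemma exists_letter : exists c : YT, True.
Proof.
have [[w _]|/nonemptyPn e] := pselect ([set: Om] !=set0); first by exists (Y 0 w).
by have := Pr_setT P; rewrite e Pr_set0 => /eqP; rewrite eq_sym oner_eq0.
Qed.

(** By permutation invariance of S, the entry queried at the decoded string serves every x of the
    same composition. *)
Lemma tab_digits u t (x : seq XT) : digits #|XT| kappa u t -> (size x <= kappa)%N ->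
  num K (map (@letter XT) x) = u -> tab t = tab (map (@letter XT) x).
Proof.
move=> [t1 t2 t3] xk xu; have [x' x't] := letter_surj t1.
rewrite -x't; apply: S_list_perm => //; apply: perm_letter.
by rewrite x't; apply: (perm_composition xk t1 t2); rewrite compositionE t3 xu.
Qed.

(** Quotient and remainder by [#|YT|] recover both letters from the index, so the sum in [input] has
    a single term. *)
Lemma cell_input x y : cell #|YT| (input P kappa X Y) (letter x) (letter y) =
  Pr P [set w | X 0%N w = x /\ Y 0%N w = y].
Proof.
rewrite /cell /= (big_pred1 (x, y)) // => -[a b] /=.
apply/eqP/eqP => [e|[-> ->] //].
have b0 : (0 < #|YT|)%N by apply: leq_ltn_trans (letter_lt b).
have e1 := congr1 (divn^~ #|YT|) e; have e2 := congr1 (modn^~ #|YT|) e.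
rewrite /= !divnMDl // !divn_small ?letter_lt // !addn0 in e1.
rewrite /= !modnMDl !modn_small ?letter_lt // in e2.
by congr (_, _); apply: letter_inj.
Qed.

Lemma row_sum (F : nat -> R) (y : seq YT) t : (size y <= kappa)%N ->
  digits #|YT| kappa (comp y) t ->
  \sum_(u < K ^ #|XT|) F u * (row_poly #|XT| K (cell #|YT| (input P kappa X Y)) t)`_u =
  \sum_(x : (size y).-tuple XT) F (num K (map (@letter XT) x)) *
    \prod_(l <- zip x y) Pr P [set w | X 0%N w = l.1 /\ Y 0%N w = l.2].
Proof.
move=> yk [t1 t2 t3].
rewrite (row_poly_perm _ _ _ (perm_composition yk t1 t2 t3)) row_poly_sum; last first.
  by move=> x; rewrite -compositionE; apply: composition_lt; rewrite size_tuple.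
apply: eq_bigr => x _; congr (_ * _); apply: eq_bigr => l _.
exact: cell_input.
Qed.

Lemma program_run : exists (M : nat) (s : memory R) (t : nat),
  [/\ last_index P kappa Y S M,
      run tab acc (program #|XT| #|YT|) (input P kappa X Y) s t,
      output P kappa Y S M s
    & (t <= time_bound N acc (program #|XT| #|YT|))%N].
Proof.
have [c0 _] := exists_letter.
have leN n : (n <= (#|XT| + #|YT|).+1)%N -> (K ^ n <= N)%N.
  by move=> h1; rewrite leq_pexp2l.
have aN : (K ^ #|XT| <= N)%N by apply: leN; lia.
have bN : (K ^ #|YT| <= N)%N by apply: leN; lia.
have KN : (K <= N)%N by rewrite -[X in (X <= _)%N]expn1; apply: leN.
suff [s [t [r tb [_ [M [lM oM]]]]]] : wp (program #|XT| #|YT|)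
    (@final_state R d Om P YT Y S kappa) (input P kappa X Y).
  by exists M, s, t.
set s0 := input P kappa X Y.
have k0 : imem s0 0 0 = kappa by [].
apply/wp_seq/wp_seq; apply: wp_mono (cpowers_spec tab acc (#|XT| + #|YT|) KN k0) => s1 f1 pw.
have f1i k : k \notin [:: 4; 20]%N -> imem s1 k = imem s0 k.
  rewrite !inE !negb_or => /andP[k1 k2]; rewrite (frame_i f1) //= k1 untouched_i_CSeqs // => i /=.
  by rewrite k1 k2.
have f1r k : rmem s1 k = rmem s0 k by rewrite (frame_r f1) //= untouched_r_CSeqs.
have pwa : powers_ok K #|XT| s1 by move=> i ia; apply: pw; rewrite (leq_trans ia) ?leq_addr.
have pwb : powers_ok K #|YT| s1 by move=> i ia; apply: pw; rewrite (leq_trans ia) ?leq_addl.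
apply/wp_seq; apply: wp_mono (cquery_spec tab acc pwa aN) => s2 f2 q2.
have f2i k : k \notin [:: 5; 8; 9; 11]%N -> imem s2 k = imem s1 k.
  move=> kn; rewrite (frame_i f2) //=; move: kn; rewrite !inE !negb_or => /and4P[k1 k2 k3 k4].
  by rewrite k2 k3 k4 cdecode_untouched_i // !inE !negb_or k1 k2 k3.
have f2r k : k != 4%N -> rmem s2 k = rmem s1 k.
  by move=> k4; rewrite (frame_r f2) //= k4 cdecode_untouched_r.
have pwa2 : powers_ok K #|XT| s2 by move=> i ia; rewrite f2i // pwa.
have pwb2 : powers_ok K #|YT| s2 by move=> i ia; rewrite f2i // pwb.
have k2 : imem s2 0 0 = kappa by rewrite f2i // f1i.
have pad v : (v < K ^ #|XT|)%N -> rmem s2 5 v = 0 by move=> _; rewrite f2r // f1r.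
apply: wp_mono (crows_spec tab acc pwa2 pwb2 aN bN k2 pad) => s3 f3 c3.
have f3i k : k \notin [:: 3; 5; 8; 9; 12; 13; 14; 15]%N -> imem s3 k = imem s2 k.
  move=> kn; rewrite (frame_i f3) //; move: kn.
  rewrite !inE !negb_or => H; move: H; do ![case/andP => ?] => ?.
  by rewrite /= cdecode_untouched_i ?inE ?negb_or; do ?[apply/andP; split].
have cellE : cell #|YT| s2 = cell #|YT| (input P kappa X Y).
  by rewrite /cell f2r // f1r.
have row_c (y : seq YT) : (size y <= kappa)%N -> exists t,
    [/\ digits #|YT| kappa (comp y) t, imem s3 3 (comp y) = (1 - (kappa - size y))%N,
      rmem s3 6 (comp y) = a_ P Y S y & rmem s3 7 (comp y) = h y].
  move=> yk; have [t [t1 t2 t3 t4]] := c3 _ (composition_lt yk); exists t.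
  have [d1 d2 d3] := t1.
  have st : size t = size y.
    by rewrite (perm_size (perm_composition yk d1 d2 d3)) size_map.
  have qx (x : (size y).-tuple XT) :
      rmem s2 4 (num K (map (@letter XT) x)) = tab (map (@letter XT) x).
    have xk : (size x <= kappa)%N by rewrite size_tuple.
    have xN : (num K (map (@letter XT) x) < K ^ #|XT|)%N.
      by rewrite -compositionE; exact: composition_lt.
    have [w w1 ->] := q2 _ xN; exact: (tab_digits w1 xk).
  split => //; first by rewrite t2 st.
    rewrite t3 cellE (row_sum (fun u => 1 - rmem s2 4 u) yk t1) (a_sum XYiid Sdisc S_gt0 indep yk).
    by apply: eq_bigr => x _; rewrite qx.
  rewrite t4 cellE (row_sum (fun u => rmem s2 4 u) yk t1) /h (Pr_S_le XYiid Sdisc S_gt0 indep yk).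
  by apply: eq_bigr => x _; rewrite qx.
apply/wp_seq/wp_iset => /=; set s4 := set_i _ _ _ _.
have pw4 : powers_ok K #|YT| s4.
  by move=> i ia; rewrite /s4 /= !updE /= f3i // pwb2.
have base4 : base_ok P Y S kappa h s4.
  by split => // y /row_c[t []].
have f41 k : k \notin [:: 2; 3; 5; 8; 9; 11; 12; 13; 14; 15; 4; 20]%N -> imem s4 k = imem s0 k.
  move=> kn; rewrite /s4 /= upd_neq; last by move: kn; rewrite !inE !negb_or => /andP[].
  move: kn; rewrite !inE !negb_or => H; move: H; do ![case/andP => ?] => ?.
  rewrite f3i ?inE ?negb_or; last by do ?[apply/andP; split].
  rewrite f2i ?inE ?negb_or; last by do ?[apply/andP; split].
  by rewrite f1i ?inE ?negb_or; last by do ?[apply/andP; split].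
have stop4 (y : seq YT) : (size y <= kappa)%N -> stop_at kappa 0 s4 y = (size y == kappa).
  move=> yk; rewrite /stop_at add0n /s4 /= updE /=; have [t [_ -> _ _]] := row_c _ yk.
  by move: yk; lia.
have inv4 : round_inv P Y S kappa 0 s4.
  split.
  - by split; rewrite f41.
  - by move=> k /andP[k1 k00]; move: k1; rewrite leqNgt; lia.
  - move=> m; rewrite leqn0 => /eqP ->; rewrite mul0n; split=> [c cN|y yk|].
    + by rewrite add0n /s4 /= updE /=; have [t [_ -> _ _]] := c3 _ cN; rewrite leq_subr.
    + by rewrite stop4 yk.
    + rewrite /= setT_cut; apply: cut_tree_ext => y yk; by rewrite stop4.
  - split=> m; first by rewrite leqn0 => /eqP ->; rewrite /s4 /= ?updE.
    by rewrite ltn0 andbF.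
  - by [].
(* The loop exits on a flag, so its last pass ends in [final_state]; until then the number of marked
   compositions bounds [j]. *)
apply: (wp_while (I := fun j s => round_inv P Y S kappa j s \/ final_state P Y S kappa s)).
- by left.
- move=> j s f /=; rewrite leqn0 => /eqP s18 [inv|[s181 _]]; last by rewrite s181 in s18.
  split.
    have [_ _ _ _ jo] := inv; apply: leq_ltn_trans jo _.
    apply: leq_ltn_trans (max_card _) _; rewrite card_ord ltn_exp2l //; lia.
  have bs : base_ok P Y S kappa h s.
    have [b1 b2 b3] := base4; split=> [i ia|y yk|y yk].
    + by rewrite (frame_i (k := 4) f) ?b1 //; exact: (@cround_untouched_i YT 4 isT).
    + by rewrite (frame_r (k := 6) f) ?b2 //; exact: (@cround_untouched_r YT 6 isT).
    + by rewrite (frame_r (k := 7) f) ?b3 //; exact: (@cround_untouched_r YT 7 isT).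
  apply: (cround_spec c0 tab acc _ _ _ _ bN bs inv).
  + by move=> y; exact: (b_next XYiid Sdisc).
  + exact: (b_nil XYiid Sdisc).
  + by move=> stop hs; exact: (Pr_tree_time XYiid Sdisc c0 hs).
  + by move=> stop hs; exact: (expectation_tree_time XYiid Sdisc c0 hs).
- move=> j s f /=; rewrite -ltnNge => s18 [[[_ _ s180] _ _ _ _]|//].
  by rewrite s180 in s18.
Qed.

End Main.

Theorem corollary10 (XT YT : finType) :
  exists prog : cmd, forall access : nat, exists C k : nat,
  forall (R : realType) (d : measure_display) (Om : measurableType d)
    (P : probability Om R) (X : nat -> Om -> XT) (Y : nat -> Om -> YT)
    (S : Om -> nat) (kappa : nat),
    (1 <= kappa)%N ->
    iid P (fun i w => (X i w, Y i w)) ->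
    stopping_time P X S ->
    independent_randomization P X Y S ->
    (forall w, (1 <= S w)%N) ->
    {ae P, forall w, (S w <= kappa)%N} ->
    permutation_invariant P kappa X S ->
    (forall m, reaches P kappa Y S m ->
       permutation_invariant P kappa Y
         (tree_time Y (algo_tree P kappa Y S m))) ->
    exists (M : nat) (s : memory R) (t : nat),
      [/\ last_index P kappa Y S M,
          run (S_list P kappa X S) (access * kappa) prog
            (input P kappa X Y) s t,
          output P kappa Y S M s
        & (t <= C * kappa ^ k)%N].
Proof.
exists (program #|XT| #|YT|) => access.
have [C0 [k0 tb]] := time_bound_poly (program #|XT| #|YT|).
pose n := (#|XT| + #|YT|).+1.
(* For [kappa >= 1], (kappa + 1)^n is at most 2^n * kappa^n; the access time and the final successor
   are absorbed by [access + 1] further multiples of kappa^n. *)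
exists (C0 * (2 ^ n + access + 1) ^ k0)%N, (n * k0)%N.
move=> R d Om P X Y S kappa k1 XYiid [Sdisc _] indep S1 _ S_perm _.
have [M [s [t [lM rn oM tt]]]] :=
  program_run k1 XYiid Sdisc indep S1 S_perm (access * kappa).
exists M, s, t; split => //; apply: leq_trans tt (leq_trans (tb _ _) _).
rewrite -mulnA expnM -expnMn leq_mul2l; apply/orP; right.
have kn : (kappa.+1 ^ n <= 2 ^ n * kappa ^ n)%N.
  by rewrite -expnMn leq_exp2r // mul2n -addnn -addn1 leq_add2l.
have k1n : (kappa <= kappa ^ n)%N by rewrite -[X in (X <= _)%N]expn1 leq_pexp2l.
have base : ((kappa.+1 ^ n + access * kappa).+1 <=
    (2 ^ n + access + 1) * kappa ^ n)%N.
  have := leq_mul (leqnn access) k1n; lia.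
by case: (k0) => [|k']; rewrite ?expn0 // leq_exp2r.
Qed.
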